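(* Let $D$ be an oriented virtual knot diagram and let $c$ be a classical crossing in $D$. If $\operatorname{Ind}(c)\neq 0$ or there exists $n\in\mathcal{N}_D$ such that $\nabla J_n(D_c)\neq\pm\nabla J_n(D)$, then $c$ is not a cosmetic crossing.
   Context: $\mathbb{N}$ denotes the positive integers. A virtual knot diagram is a one-component planar knot diagram whose double points are either classical crossings (with over/under information) or virtual crossings. An oriented virtual knot is an equivalence class of oriented virtual knot diagrams under planar isotopy, the classical Reidemeister moves RI, RII, RIII, the virtual Reidemeister moves VRI, VRII, VRIII (the same moves with all crossings virtual), and the semi-virtual move SV (an arc with two consecutive virtual crossings is moved past a classical crossing). $C(D)$ is the set of classical crossings of $D$. Cosmetic: a crossing change at a classical crossing $c$ of $D$ (switching over and under at $c$) is cosmetic if the resulting oriented diagram $D'$ is equivalent, as an oriented virtual knot diagram, to $D$; in this case $c$ is called a cosmetic crossing. Sign: draw a classical crossing $c$ with both strands oriented upward. Then $\operatorname{sgn}(c)=+1$ if the over-strand goes from bottom left to top right, and $\operatorname{sgn}(c)=-1$ if the over-strand goes from bottom right to top left. Index: an arc is an edge of $D$ between two consecutive classical crossings along the orientation. Label all arcs by integers so that labels are unchanged at virtual crossings and, at each classical crossing drawn with both strands oriented upward (whatever its sign), if the incoming arc on the left (bottom left) has label $a$ and the incoming arc on the right (bottom right) has label $b$, then the outgoing arc at top left has label $b+1$ and the outgoing arc at top right has label $a-1$. Such a labeling always exists: for example, label an arc $\alpha$ by $\lambda(\alpha)=\sum_{c\in O(\alpha)}\operatorname{sgn}(c)$,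 where $O(\alpha)$ is the set of classical crossings first met as overcrossings when traveling along the orientation starting from $\alpha$. Then $\operatorname{Ind}(c)=\operatorname{sgn}(c)(a-b-1)$. Dwrithe: for $n\in\mathbb{Z}\setminus\{0\}$, the $n$-th writhe is $J_n(D)=\sum_{c\in C(D),\,\operatorname{Ind}(c)=n}\operatorname{sgn}(c)$. For $n\in\mathbb{N}$ the $n$-th dwrithe is $\nabla J_n(D)=J_n(D)-J_{-n}(D)$. Smoothing against orientation: for $c\in C(D)$, $D_c$ is the oriented virtual knot diagram obtained by deleting $c$ and reconnecting so that (with both strands at $c$ oriented upward) the two top ends are joined to each other and the two bottom ends are joined to each other. The result is a one-component diagram, oriented as follows: the path of $D$ that leaves $c$ along the over-strand and returns to $c$ along the under-strand keeps its orientation, and the path that leaves $c$ along the under-strand and returns along the over-strand has its orientation reversed. The set $\mathcal{N}_D$: for a diagram $E$ let $S(E)=\{|\operatorname{Ind}(c)| : c\in C(E)\}\cap\mathbb{N}$, where $\operatorname{Ind}$ is computed in $E$; then $\mathcal{N}_D=S(D)\cup\bigcup_{c\in C(D)}S(D_c)\subset\mathbb{N}$. *)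

(* Defs.v *)
From mathcomp Require Import all_boot all_order all_algebra.
From Stdlib Require Import Relation_Operators.

Set Implicit Arguments.
Unset Strict Implicit.
Unset Printing Implicit Defensive.

Import GRing.Theory.

(* An oriented one-component planar diagram with a base point on the curve is
   recorded by the list of the passages through its double points, in the order
   in which they are met when travelling from the base point.

   Every double point, classical or virtual, is drawn with both strands
   oriented upward; [from_left p] tells whether passage [p] is along the strand
   going from bottom left to top right ([true]) or along the one going from
   bottom right to top left ([false]). *)

Inductive level := Over | Under | Virtual.

Definition is_over (l : level) : bool := if l is Over then true else false.
Definition is_under (l : level) : bool := if l is Under then true else false.
Definition is_virtual (l : level) : bool := if l is Virtual then true else false.

(* Level of the other strand of the same double point. *)
Definition opposite (l : level) : level :=
  match l with Over => Under | Under => Over | Virtual => Virtual end.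

Record passage := Passage { label : nat; from_left : bool; height : level }.

Definition code := seq passage.

(* The base point is chosen on the boundary of the unbounded region of the
   plane; [outer_left] tells whether that region lies to the left or to the
   right of the curve at the base point. *)
Record diagram := Diagram { word : code; outer_left : bool }.

Definition through (x : nat) (p : passage) : bool := label p == x.

Definition two_passages (w : code) (x : nat) : bool :=
  match [seq p <- w | through x p] with
  | [:: p; q] =>
      (from_left q == ~~ from_left p) &&
      match height p, height q with
      | Over, Under | Under, Over | Virtual, Virtual => true
      | _, _ => false
      end
  | _ => false
  end.

Definition valid_code (w : code) : bool := all (two_passages w) (map label w).

(* Index of the other passage through the double point met by passage [i]. *)
Definition twin (w : code) (i : nat) : nat :=
  let s := map label w in
  let x := nth 0 s i in
  if index x s == i then i.+1 + index x (drop i.+1 s) else index x s.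

(* The double points and the base point, the latter seen as a bivalent vertex,
   cut the curve into [(size w).+1] edges: edge [i] ends at passage [i], the
   last edge ends at the base point.  A dart is an edge together with a
   direction of travel, [true] being that of the orientation. *)
Definition dart (w : code) : finType := ('I_(size w).+1 * bool)%type.

(* The dart following passage [k], reached in direction [fwd], on the boundary
   of the region on the left: it is obtained by turning left at the double
   point.  For instance, coming in from bottom left one leaves by top left. *)
Definition turn_left (w : code) (k : nat) (fwd : bool) : dart w :=
  let fwd' := fwd == nth false (map from_left w) k in
  (inord (if fwd' then (twin w k).+1 else twin w k), fwd').

Definition next_dart (w : code) (d : dart w) : dart w :=
  let: (i, fwd) := d in
  if fwd then
    if i == size w :> nat then (ord0, true) else turn_left w i true
  else
    if i == 0 :> nat then (ord_max, false) else turn_left w i.-1 false.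

(* Regions are the orbits of [next_dart]; there are [(size w)./2.+1] vertices
   and [(size w).+1] edges, so this is Euler's formula V - E + F = 2. *)
Definition planar_code (w : code) : bool :=
  fcard (@next_dart w) predT == (size w)./2 + 2.

Definition virtual_knot_diagram (D : diagram) : bool :=
  valid_code (word D) && planar_code (word D).

(* Planar isotopy: the names of the double points and the choice of the base
   point on the boundary of the unbounded region are immaterial. *)

Definition rename (f : nat -> nat) (p : passage) : passage :=
  Passage (f (label p)) (from_left p) (height p).

Inductive isotopy (D : diagram) : diagram -> Prop :=
| Rename (f : nat -> nat) :
    injective f ->
    isotopy D (Diagram (map (rename f) (word D)) (outer_left D))
| Rebase (k : 'I_(size (word D)).+1) (b : bool) :
    fconnect (@next_dart (word D)) (ord0, outer_left D) (k, b) ->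
    isotopy D (Diagram (rot k (word D)) b).

(* Reidemeister moves.  The base point is kept outside of the disc in which the
   move takes place. *)

Definition kink (x : nat) (s : bool) (l : level) : code :=
  [:: Passage x s l; Passage x (~~ s) (opposite l)].

Definition along (e : bool) (w : code) : code := if e then w else rev w.

(* The two strands of a bigon: the first one is at level [l] at both vertices,
   and the second one runs in the same direction iff [d]. *)
Definition bigon1 (x y : nat) (s : bool) (l : level) : code :=
  [:: Passage x s l; Passage y (~~ s) l].
Definition bigon2 (x y : nat) (s : bool) (l : level) (d : bool) : code :=
  along d [:: Passage x (~~ s) (opposite l); Passage y s (opposite l)].

(* The three strands of a triangle.  Strands 1, 2, 3 carry its sides in
   counterclockwise order, x = 1 & 2, y = 2 & 3, z = 3 & 1 are its vertices, and
   [ei] tells whether strand [i] has the triangle on its left.  When the strands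
   are all oriented counterclockwise around the triangle, strand i+1 crosses
   strand i from right to left, so that strand i is the one coming from bottom
   left; reversing exactly one of them exchanges the two roles. *)
Record triangle := Triangle {
  e1 : bool; e2 : bool; e3 : bool;
  vx : nat; vy : nat; vz : nat;
  lx : level; (* level of strand 1 at x *)
  ly : level; (* level of strand 2 at y *)
  lz : level  (* level of strand 3 at z *) }.

Definition strand1 (t : triangle) : code :=
  along (e1 t) [:: Passage (vz t) (e3 t != e1 t) (opposite (lz t));
                   Passage (vx t) (e1 t == e2 t) (lx t)].
Definition strand2 (t : triangle) : code :=
  along (e2 t) [:: Passage (vx t) (e1 t != e2 t) (opposite (lx t));
                   Passage (vy t) (e2 t == e3 t) (ly t)].
Definition strand3 (t : triangle) : code :=
  along (e3 t) [:: Passage (vy t) (e2 t != e3 t) (opposite (ly t));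
                   Passage (vz t) (e3 t == e1 t) (lz t)].

(* Moving each strand across the opposite vertex puts the triangle on its other
   side. *)
Definition flip_triangle (t : triangle) : triangle :=
  Triangle (~~ e1 t) (~~ e2 t) (~~ e3 t) (vx t) (vy t) (vz t)
           (lx t) (ly t) (lz t).

Definition nb_virtual (t : triangle) : nat :=
  count is_virtual [:: lx t; ly t; lz t].

(* All three vertices are classical, and the strands are not cyclically above
   each other. *)
Definition RIII_levels (t : triangle) : bool :=
  [&& nb_virtual t == 0,
      has is_over [:: lx t; ly t; lz t] & has is_under [:: lx t; ly t; lz t]].
Definition VRIII_levels (t : triangle) : bool := nb_virtual t == 3.
Definition SV_levels (t : triangle) : bool := nb_virtual t == 2.

Inductive move1 (P : pred level) : code -> code -> Prop :=
| Move1 (A B : code) x s l :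
    P l -> move1 P (A ++ B) (A ++ kink x s l ++ B).

Inductive move2 (P : pred level) : code -> code -> Prop :=
| Move2 (A B C : code) x y s l d :
    P l ->
    move2 P (A ++ B ++ C) (A ++ bigon1 x y s l ++ B ++ bigon2 x y s l d ++ C).

(* Up to a cyclic renumbering of the strands, strand 1 is met first. *)
Inductive move3 (P : pred triangle) : code -> code -> Prop :=
| Move3_123 (A B C E : code) t :
    P t ->
    move3 P (A ++ strand1 t ++ B ++ strand2 t ++ C ++ strand3 t ++ E)
            (A ++ strand1 (flip_triangle t) ++ B ++ strand2 (flip_triangle t)
               ++ C ++ strand3 (flip_triangle t) ++ E)
| Move3_132 (A B C E : code) t :
    P t ->
    move3 P (A ++ strand1 t ++ B ++ strand3 t ++ C ++ strand2 t ++ E)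
            (A ++ strand1 (flip_triangle t) ++ B ++ strand3 (flip_triangle t)
               ++ C ++ strand2 (flip_triangle t) ++ E).

Definition is_classical (l : level) : bool := ~~ is_virtual l.

Definition RI := move1 is_classical.
Definition RII := move2 is_classical.
Definition RIII := move3 RIII_levels.
Definition VRI := move1 is_virtual.
Definition VRII := move2 is_virtual.
Definition VRIII := move3 VRIII_levels.
Definition SV := move3 SV_levels.

Definition move (w w' : code) : Prop :=
  RI w w' \/ RII w w' \/ RIII w w' \/
  VRI w w' \/ VRII w w' \/ VRIII w w' \/ SV w w'.

(* Both diagrams are required to be planar: a bigon can be created only between
   two arcs on the boundary of a common region. *)
Definition elementary (D D' : diagram) : Prop :=
  virtual_knot_diagram D /\ virtual_knot_diagram D' /\
  (isotopy D D' \/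
   outer_left D = outer_left D' /\ move (word D) (word D')).

Definition equivalent : diagram -> diagram -> Prop :=
  clos_refl_sym_trans diagram elementary.

Definition change_passage (c : nat) (p : passage) : passage :=
  if through c p then Passage (label p) (from_left p) (opposite (height p))
  else p.

Definition crossing_change (D : diagram) (c : nat) : diagram :=
  Diagram (map (change_passage c) (word D)) (outer_left D).

(* Each classical crossing is listed once, at its overcrossing. *)
Definition classical_crossings (D : diagram) : seq nat :=
  [seq label p | p <- word D & is_over (height p)].

Definition cosmetic (D : diagram) (c : nat) : Prop :=
  equivalent (crossing_change D c) D.

Local Open Scope ring_scope.

Definition sgn (D : diagram) (c : nat) : int :=
  if has (fun p => [&& through c p, is_over (height p) & from_left p]) (word D)
  then 1 else -1.

(* Change of the label along a passage: the strand from bottom left with label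
   [a] leaves with label [a - 1], the one from bottom right with label [b]
   leaves with label [b + 1]. *)
Definition label_shift (p : passage) : int :=
  if is_virtual (height p) then 0 else if from_left p then -1 else 1.

(* [lam i] is the label of edge [i]; the base point does not change labels. *)
Definition arc_labeling (D : diagram) (lam : nat -> int) : Prop :=
  lam (size (word D)) = lam 0%N /\
  forall (A B : code) p, word D = A ++ p :: B ->
    lam (size A).+1 = lam (size A) + label_shift p.

(* The labeling with label 0 at the base point. *)
Definition arc_label (D : diagram) (i : nat) : int :=
  \sum_(p <- take i (word D)) label_shift p.

(* Index of the passage through [c] from bottom left ([s = true]) or from bottom
   right ([s = false]). *)
Definition position (D : diagram) (c : nat) (s : bool) : nat :=
  find (fun p => through c p && (from_left p == s)) (word D).

Definition Ind_of (lam : nat -> int) (D : diagram) (c : nat) : int :=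
  sgn D c * (lam (position D c true) - lam (position D c false) - 1).

Definition Ind (D : diagram) (c : nat) : int := Ind_of (arc_label D) D c.

Lemma sum_by_label (X : seq nat) (w : code) (F : passage -> int) :
  uniq X -> all (fun p => label p \in X) w ->
  \sum_(p <- w) F p = \sum_(x <- X) \sum_(p <- w | through x p) F p.
Proof.
move=> uX; elim: w => [_|p w IH /= /andP[pX wX]].
  by rewrite big_nil big1 // => x _; rewrite big_nil.
rewrite big_cons IH // [RHS](eq_bigr (fun x =>
    (if x == label p then F p else 0) + \sum_(q <- w | through x q) F q)).
  rewrite big_split /=; congr (_ + _).
  rewrite (bigD1_seq (label p)) //= eqxx big1 ?addr0 //.
  by move=> x /negPf ->.
by move=> x _; rewrite big_cons /through eq_sym; case: eqP; rewrite ?add0r.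
Qed.

Lemma sum_label_shift (w : code) :
  valid_code w -> \sum_(p <- w) label_shift p = 0.
Proof.
move=> vw; rewrite (@sum_by_label (undup (map label w))) ?undup_uniq //; last first.
  have: all (mem (map label w)) (map label w) by apply/allP.
  by rewrite all_map; apply: sub_all => p /=; rewrite mem_undup.
rewrite big_seq big1 // => x; rewrite mem_undup => /(allP vw).
rewrite /two_passages -big_filter.
case: [seq p <- w | through x p] => [|p [|q [|? ?]]] //= /andP[/eqP sq hq].
rewrite !big_cons big_nil /label_shift sq.
by case: (height p) (height q) hq => -[] //= _; case: (from_left p).
Qed.

Lemma arc_labeling_arc_label (D : diagram) :
  valid_code (word D) -> arc_labeling D (arc_label D).
Proof.
move=> vD; rewrite /arc_labeling /arc_label take_size take0 big_nil.
rewrite sum_label_shift //; split=> // A B p ->.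
rewrite -cat_rcons take_size_cat ?size_rcons // cat_rcons take_size_cat //.
by rewrite big_rcons.
Qed.

(* The index does not depend on the choice of the labeling. *)
Lemma Ind_arc_labeling (D : diagram) (lam : nat -> int) (c : nat) :
  arc_labeling D lam -> Ind_of lam D c = Ind D c.
Proof.
move=> [_ lamD].
have lamE i : (i <= size (word D))%N -> lam i = lam 0%N + arc_label D i.
  elim: i => [_|i IH ltiD]; first by rewrite /arc_label take0 big_nil addr0.
  case defE: (drop i (word D)) => [|p B].
    by move: (size_drop i (word D)); rewrite defE => /esym/eqP;
       rewrite subn_eq0 leqNgt ltiD.
  have defD: word D = take i (word D) ++ p :: B by rewrite -defE cat_take_drop.
  have szi: size (take i (word D)) = i by rewrite size_takel // ltnW.
  move: (lamD _ _ _ defD); rewrite szi IH; last exact: ltnW.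
  rewrite /arc_label => ->; rewrite -addrA; congr (_ + _).
  rewrite [in RHS]defD -cat_rcons take_size_cat ?size_rcons ?szi //.
  by rewrite big_rcons.
rewrite /Ind /Ind_of; congr (_ * (_ - _)).
rewrite (lamE (position D c true)) ?(lamE (position D c false)) ?find_size //.
by rewrite opprD addrACA subrr add0r.
Qed.

Definition writhe (n : int) (D : diagram) : int :=
  \sum_(c <- classical_crossings D | Ind D c == n) sgn D c.

Definition dwrithe (n : nat) (D : diagram) : int :=
  writhe n%:Z D - writhe (- n%:Z) D.

(* Reversing one of the two strands of a double point, and drawing it again with
   both strands upward, exchanges the left and the right strand; reversing both
   does not. *)
Definition exchange_sides (P : pred nat) (p : passage) : passage :=
  if P (label p) then Passage (label p) (~~ from_left p) (height p) else p.

(* Smoothing against orientation.  Write the word as A, p, B, q, C where p and q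
   are the passages through [c].  If p is the undercrossing, then B leaves c
   along the under-strand and is reversed; otherwise it is the path C, A, which
   contains the base point, that is reversed.  The double points met by both
   paths are those with exactly one strand reversed. *)
Definition smooth (D : diagram) (c : nat) : diagram :=
  let w := word D in
  let i := find (through c) w in
  let A := take i w in
  let w1 := drop i.+1 w in
  let j := find (through c) w1 in
  let B := take j w1 in
  let C := drop j.+1 w1 in
  let mixed x := has (through x) B && has (through x) (A ++ C) in
  if has (fun p => through c p && is_under (height p)) (take i.+1 w) then
    Diagram (map (exchange_sides mixed) (A ++ rev B ++ C)) (outer_left D)
  else
    Diagram (map (exchange_sides mixed) (rev C ++ B ++ rev A)) (~~ outer_left D).

Definition abs_indices (D : diagram) : pred nat :=
  [pred n | (0 < n)%N & has (fun c => `|Ind D c|%N == n) (classical_crossings D)].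

Definition index_set (D : diagram) : pred nat :=
  [pred n | (n \in abs_indices D) ||
            has (fun c => n \in abs_indices (smooth D c)) (classical_crossings D)].

(* Main.v *)
Require Import Defs.
From HB Require Import structures.
From mathcomp Require Import all_boot all_order all_algebra.
From mathcomp Require Import zify ring.
From Stdlib Require Import Relation_Operators.

(** A diagram is read through its Gauss word, the cyclic list of its passages through
    classical crossings. Virtual crossings do not change arc labels, so the virtual and
    semi-virtual moves leave the Gauss word alone, and [invariant_equivalent] reduces
    the invariance of a function of Gauss words to relabeling, change of base point,
    kinks, bigons and triangles. The index of a crossing is, up to sign, the total label
    change on the path from its first passage to the second one; hence writhes and
    dwrithes are sums over the pairs of passages with the same label of a weight that
    depends on the first passage and on the total change in between ([chord_sum],
    [writhe_chord_sum], [dwrithe_chord_sum]).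

    If the index [n] of c is not 0, the [n]-th writhe is an invariant
    ([writhe_equivalent]). The crossing change keeps all labels, turns the index of c
    into [- n] and keeps the other indices and signs, so that the [n]-th writhe loses
    exactly the sign of c and c is not cosmetic ([not_cosmetic_index]).

    The [n]-th dwrithe does not depend on the levels of the crossings, and it changes
    sign with the orientation of the diagram. Therefore the absolute value of the
    dwrithe of the smoothing at a crossing depends neither on the levels, that of the
    smoothed crossing included, nor on the orientation of the smoothing. For every [k]
    other than the absolute dwrithe of D itself, the sum of the signs of the crossings
    whose smoothing has absolute dwrithe [k] is an invariant
    ([smooth_invariant_equivalent]):
    - the smoothing at a kink is D up to orientation, so a kink is not counted;
    - the two vertices of a bigon have opposite signs, and their smoothings have the
      same absolute dwrithe;
    - the smoothings at corresponding crossings before and after a triangle move are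
      related by a triangle move, by two bigon moves, or are the same curve with the
      two other vertices exchanged.
    If the dwrithe of the smoothing at c is not the one of D up to sign, take for [k]
    its absolute value: the crossing change at c turns the sign of c into its opposite
    and keeps all other terms, so the sum changes by 2 or -2
    ([not_cosmetic_smooth]). *)

Set Implicit Arguments.
Unset Strict Implicit.
Unset Printing Implicit Defensive.

Import GRing.Theory Num.Theory.
Local Open Scope ring_scope.

(** * Gauss words and chord sums *)

(** A passage through a classical crossing: its label, whether it runs from bottom
    left, and whether it is the overcrossing. Seen on the circle that parametrizes the
    knot, it is an endpoint of the chord of that crossing. *)
Definition endpoint := (nat * bool * bool)%type.
Definition lab (p : endpoint) : nat := p.1.1.
Definition lft (p : endpoint) : bool := p.1.2.
Definition ovr (p : endpoint) : bool := p.2.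
(** Change of the arc label along the passage. *)
Definition shift (p : endpoint) : int := if lft p then -1 else 1.
Definition shift_sum (w : seq endpoint) : int := \sum_(p <- w) shift p.

Lemma shift_sum_cat u v : shift_sum (u ++ v) = shift_sum u + shift_sum v.
Proof. exact: big_cat. Qed.
Lemma shift_sum_cons p w : shift_sum (p :: w) = shift p + shift_sum w.
Proof. exact: big_cons. Qed.
Lemma shift_sum_nil : shift_sum [::] = 0.
Proof. exact: big_nil. Qed.
Lemma shift_sum_rev w : shift_sum (rev w) = shift_sum w.
Proof. exact: perm_big (permEl (perm_rev w)). Qed.
Definition shift_sumE := (shift_sum_cat, shift_sum_cons, shift_sum_nil,
  shift_sum_rev).

Definition on (x : nat) (p : endpoint) : bool := lab p == x.
(** No passage of [w] has label [x]. *)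
Definition misses (x : nat) (w : seq endpoint) : bool := ~~ has (on x) w.

Section ChordSum.
Variable F : endpoint -> int -> int.

(** Sum of [F p] over the passages of [w] with the label of [p], evaluated at [S] plus
    the total shift of what precedes them in [w]. *)
Fixpoint hits (p : endpoint) (S : int) (w : seq endpoint) : int :=
  if w is q :: w' then
    (if lab q == lab p then F p S else 0) + hits p (S + shift q) w'
  else 0.

(** Sum over the pairs of passages with the same label, [p] being the first one, of
    [F p S] with [S] the total shift strictly between them. For the Gauss word of a
    diagram there is one term for each crossing. *)
Fixpoint chord_sum (w : seq endpoint) : int :=
  if w is p :: w' then hits p 0 w' + chord_sum w' else 0.

(** The same sum over the pairs that have their first passage in [u] and the second
    one in [v], when the part of the word between [u] and [v] has total shift [S]. *)
Fixpoint cross_sum (u : seq endpoint) (S : int) (v : seq endpoint) : int :=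
  if u is p :: u' then hits p (shift_sum u' + S) v + cross_sum u' S v else 0.

Lemma hits_cat p S u v :
  hits p S (u ++ v) = hits p S u + hits p (S + shift_sum u) v.
Proof.
elim: u S => [|q u IH] S /=; first by rewrite shift_sum_nil addr0 add0r.
by rewrite IH shift_sum_cons !addrA.
Qed.

Lemma chord_sum_cat u v :
  chord_sum (u ++ v) = chord_sum u + chord_sum v + cross_sum u 0 v.
Proof.
elim: u => [|p u IH] /=; first by rewrite add0r addr0.
rewrite IH hits_cat add0r addr0; ring.
Qed.

Lemma cross_sum_catl u v S w :
  cross_sum (u ++ v) S w = cross_sum u (shift_sum v + S) w + cross_sum v S w.
Proof.
elim: u => [|p u IH] /=; first by rewrite add0r.
by rewrite IH shift_sum_cat !addrA.
Qed.

Lemma cross_sum_catr u S v w :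
  cross_sum u S (v ++ w) = cross_sum u S v + cross_sum u (S + shift_sum v) w.
Proof.
elim: u => [|p u IH] /=; first by rewrite addr0.
rewrite IH hits_cat !addrA; ring.
Qed.

Lemma cross_sum_nill S v : cross_sum [::] S v = 0.
Proof. by []. Qed.

Lemma cross_sum_nilr u S : cross_sum u S [::] = 0.
Proof. by elim: u => //= p u ->; rewrite addr0. Qed.

Lemma cross_sum_consl p u S v :
  cross_sum (p :: u) S v = hits p (shift_sum u + S) v + cross_sum u S v.
Proof. by []. Qed.

(** The contribution to [cross_sum] of one passage [q] on the right. Naming it lets
    the expansion rules [chord_sumE] terminate. *)
Definition hits_back (q : endpoint) (S : int) (u : seq endpoint) : int :=
  cross_sum u S [:: q].

Lemma cross_sum_consr u S q v :
  cross_sum u S (q :: v) = hits_back q S u + cross_sum u (S + shift q) v.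
Proof. by rewrite -cat1s cross_sum_catr shift_sum_cons shift_sum_nil addr0. Qed.

Lemma hits_back_nil q S : hits_back q S [::] = 0. Proof. by []. Qed.

Lemma hits_back_cons q S p u :
  hits_back q S (p :: u) =
  (if lab q == lab p then F p (shift_sum u + S) else 0) + hits_back q S u.
Proof. by rewrite /hits_back /= addr0. Qed.

Lemma hits_nil p S : hits p S [::] = 0. Proof. by []. Qed.

Lemma hits_cons p S q w :
  hits p S (q :: w) =
  (if lab q == lab p then F p S else 0) + hits p (S + shift q) w.
Proof. by []. Qed.

Lemma chord_sum_nil : chord_sum [::] = 0. Proof. by []. Qed.

Lemma chord_sum_cons p w : chord_sum (p :: w) = hits p 0 w + chord_sum w.
Proof. by []. Qed.

Lemma misses_cons x p w : misses x (p :: w) = (lab p != x) && misses x w.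
Proof. by rewrite /misses /= negb_or. Qed.

Lemma misses_cat x u v : misses x (u ++ v) = misses x u && misses x v.
Proof. by rewrite /misses has_cat negb_or. Qed.

Lemma hits_misses p S w : misses (lab p) w -> hits p S w = 0.
Proof.
elim: w S => [|q w IH] S //=; rewrite misses_cons => /andP[/negPf-> mw].
by rewrite IH ?addr0.
Qed.

Lemma hits_back_misses q S u : misses (lab q) u -> hits_back q S u = 0.
Proof.
rewrite /hits_back; elim: u => [|p u IH] //=.
rewrite misses_cons eq_sym => /andP[/negPf-> mu].
by rewrite IH // !addr0.
Qed.

End ChordSum.

(** Expansion of the chord sum of a word made of blocks and single passages. *)
Definition chord_sumE := (chord_sum_cat, chord_sum_cons, chord_sum_nil,
  hits_cat, hits_cons, hits_nil, cross_sum_catl, cross_sum_catr,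
  cross_sum_consl, cross_sum_consr,
  hits_back_nil, hits_back_cons, cross_sum_nill, cross_sum_nilr, shift_sumE).

(** * Chord sums under kinks, bigons and triangles *)

Lemma chord_sum_kink F u v a b :
  lab b = lab a -> shift b = - shift a -> misses (lab a) (u ++ v) ->
  F a 0 = 0 -> chord_sum F (u ++ [:: a; b] ++ v) = chord_sum F (u ++ v).
Proof.
move=> lb sb; rewrite misses_cat => /andP[mu mv] F0.
have mub : misses (lab b) u by rewrite lb.
have mvb : misses (lab b) v by rewrite lb.
rewrite !chord_sumE !hits_back_misses // !hits_misses // lb eqxx F0 sb.
have ->: 0 + (shift a + (- shift a + 0)) = 0 :> int by ring.
ring.
Qed.

(** Makes equal the middle arguments of the cross sums between the same two blocks,
    when these arguments are equal by a ring identity. *)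
Ltac align :=
  repeat match goal with
  | |- context [cross_sum ?F ?u ?m ?v] =>
    match goal with |- context [cross_sum F u ?m' v] =>
      tryif constr_eq m m' then fail else
      replace (cross_sum F u m' v) with (cross_sum F u m v) by (f_equal; ring)
    end
  end.

(** The same for the values of [F] at [a]. *)
Ltac align_at F a :=
  repeat match goal with
  | |- context [F a ?m] =>
    match goal with |- context [F a ?m'] =>
      tryif constr_eq m m' then fail else
      replace (F a m') with (F a m) by (f_equal; ring)
    end
  end.

(** Both vertices of a bigon have the same total shift between their passages, hence
    terms that cancel. *)
Lemma chord_sum_bigon F (d : bool) u v w a b a' b' :
  lab a' = lab a -> lab b' = lab b -> lab b != lab a ->
  shift b = - shift a -> shift a' = - shift a -> shift b' = shift a ->
  misses (lab a) (u ++ v ++ w) -> misses (lab b) (u ++ v ++ w) ->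
  (forall S, F a S + F b S = 0) ->
  chord_sum F (u ++ [:: a; b] ++ v ++ (if d then [:: a'; b'] else [:: b'; a'])
                 ++ w) = chord_sum F (u ++ v ++ w).
Proof.
move=> la lb nab sb sa' sb'; rewrite !misses_cat.
move=> /and3P[mua mva mwa] /and3P[mub mvb mwb] Fab.
have [mua' mva' mwa'] : [/\ misses (lab a') u, misses (lab a') v &
  misses (lab a') w]
  by rewrite la.
have [mub' mvb' mwb'] : [/\ misses (lab b') u, misses (lab b') v &
  misses (lab b') w]
  by rewrite lb.
have nba : (lab a == lab b) = false by rewrite eq_sym; apply: negPf.
rewrite !chord_sumE; case: d.
all: rewrite !chord_sumE !hits_back_misses // !hits_misses // la lb !eqxx.
all: rewrite (negPf nab) nba sb sa' sb'.
all: have Fb S : F b S = - F a S by apply/eqP; rewrite -addr_eq0 addrC Fab.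
all: rewrite !Fb.
all: align.
all: align_at F a.
all: ring.
Qed.

(** The list [w], read backwards unless [e]. *)
Definition directed (T : Type) (e : bool) (w : seq T) := if e then w else rev w.

(** The vertices are x (on sides 1 and 2), y (on 2 and 3) and z (on 3 and 1). Reading
    the three pairs in the other order moves two passages into or out of the path
    between the two passages of each vertex; the sides are such that the total shift of
    this path does not change. *)
Lemma chord_sum_triangle F (e1 e2 e3 k : bool) t u v w x1 z1 x2 y2 y3 z3 :
  let s (p : endpoint) (b : bool) := lft p = b (+) k in
  lab x2 = lab x1 -> lab y3 = lab y2 -> lab z3 = lab z1 ->
  lab x1 != lab y2 -> lab y2 != lab z1 -> lab z1 != lab x1 ->
  s x1 (e1 (+) e2) -> s x2 (~~ (e1 (+) e2)) ->
  s y2 (e2 (+) e3) -> s y3 (~~ (e2 (+) e3)) ->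
  s z3 (e3 (+) e1) -> s z1 (~~ (e3 (+) e1)) ->
  let r := t ++ u ++ v ++ w in
  misses (lab x1) r -> misses (lab y2) r -> misses (lab z1) r ->
  chord_sum F (t ++ directed e1 [:: z1; x1] ++ u ++ directed e2 [:: x2; y2] ++ v ++
    directed e3 [:: y3; z3] ++ w) =
  chord_sum F (t ++ directed (~~ e1) [:: z1; x1] ++ u ++
    directed (~~ e2) [:: x2; y2] ++ v ++ directed (~~ e3) [:: y3; z3] ++ w).
Proof.
move=> s lx ly lz nxy nyz nzx sx1 sx2 sy2 sy3 sz3 sz1 r.
rewrite /r !misses_cat => /and4P[xt xu xv xw] /and4P[yt yu yv yw].
move=> /and4P[zt zu zv zw].
have [x2t x2u x2v x2w] : [/\ misses (lab x2) t, misses (lab x2) u,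
  misses (lab x2) v & misses (lab x2) w] by rewrite lx.
have [y3t y3u y3v y3w] : [/\ misses (lab y3) t, misses (lab y3) u,
  misses (lab y3) v & misses (lab y3) w] by rewrite ly.
have [z3t z3u z3v z3w] : [/\ misses (lab z3) t, misses (lab z3) u,
  misses (lab z3) v & misses (lab z3) w] by rewrite lz.
have nyx : lab y2 != lab x1 by rewrite eq_sym.
have nzy : lab z1 != lab y2 by rewrite eq_sym.
have nxz : lab x1 != lab z1 by rewrite eq_sym.
have [hx2 hy2 hy3 hz3 hz1] : [/\ shift x2 = - shift x1, shift y2 =
  (if e1 (+) e3 then -1 else 1) * shift x1,
  shift y3 = - shift y2,
  shift z3 =  (if e2 (+) e3 then -1 else 1) * shift x1 & shift z1 = - shift z3].
  rewrite /shift sx1 sx2 sy2 sy3 sz3 sz1.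
  by case: (e1); case: (e2); case: (e3); case: (k).
rewrite hz3 in hz1; rewrite hy2 in hy3.
clear -nxy nyx nzy nyz nxz nzx lx ly lz hx2 hy2 hy3 hz3 hz1 xt xu xv xw yt yu yv
  yw zt zu zv zw x2t x2u x2v x2w y3t y3u y3v y3w z3t z3u z3v z3w.
case: e1 e2 e3 hx2 hy2 hy3 hz3 hz1 => [] [] [] /= khx2 khy2 khy3 khz3 khz1.
all: rewrite !chord_sumE.
all: rewrite !hits_misses // !hits_back_misses //.
all: rewrite lx ly lz !eqxx (negPf nxy) (negPf nyx) (negPf nzy) (negPf nyz)
  (negPf nxz) (negPf nzx).
all: rewrite !(khx2, khy2, khy3, khz3, khz1) !(mul1r, mulN1r, opprK).
all: align.
all: align_at F x1; align_at F y2; align_at F z1.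
all: ring.
Qed.

(** * Words in which every label is met twice *)

(** The other passage through the same crossing. *)
Definition mate (p : endpoint) : endpoint := (lab p, ~~ lft p, ~~ ovr p).

(** Every label of [w] occurs exactly twice, on the two strands of a classical
    crossing. The condition does not depend on the order of the passages. *)
Definition gauss (w : seq endpoint) : bool :=
  uniq (map fst w) && all (fun p => mate p \in w) w.

Lemma mateK : involutive mate.
Proof. by move=> [[x s] o]; rewrite /mate /lab /lft /ovr /= !negbK. Qed.

Lemma lft_mate p : lft (mate p) = ~~ lft p. Proof. by []. Qed.
Lemma lab_mate p : lab (mate p) = lab p. Proof. by []. Qed.

Lemma shift_mate p : shift (mate p) = - shift p.
Proof. by rewrite /shift lft_mate; case: (lft p). Qed.

Lemma gauss_perm w w' : perm_eq w w' -> gauss w = gauss w'.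
Proof.
move=> ww'; rewrite /gauss (perm_uniq (perm_map fst ww')) (perm_all _ ww').
by congr (_ && _); apply: eq_all => p; rewrite (perm_mem ww').
Qed.

Lemma gauss_uniq w : gauss w -> uniq w.
Proof. by case/andP=> /map_uniq. Qed.

Lemma gauss_catC u v : gauss (u ++ v) = gauss (v ++ u).
Proof. by apply: gauss_perm; rewrite perm_catC. Qed.

(** Passages and their mates have opposite shifts. *)
Lemma gauss_shift_sum w : gauss w -> shift_sum w = 0.
Proof.
move=> gw; have /andP[_ /allP mw] := gw.
have pw : perm_eq w (map mate w).
  apply: uniq_perm; rewrite ?map_inj_uniq ?gauss_uniq //.
    exact: inv_inj mateK.
  move=> p; apply/idP/mapP => [pw|[q /mw ? ->] //].
  by exists (mate p); rewrite ?mateK // mw.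
have: shift_sum w = - shift_sum w.
  rewrite {1}/shift_sum (perm_big _ pw) big_map -sumrN.
  by apply: eq_bigr => p _; rewrite shift_mate.
by move/eqP; rewrite -addr_eq0 -mulr2n mulrn_eq0 => /eqP.
Qed.

Lemma gauss_fst_inj w : gauss w -> {in w &, injective fst}.
Proof.
case/andP=> uw _; elim: w uw => //= r w IH /andP[rw uw] p q.
rewrite !inE => /predU1P[->|pw] /predU1P[->|qw] // e; last exact: IH.
- by rewrite e map_f in rw.
- by rewrite -e map_f in rw.
Qed.

Lemma gauss_mate A B C p q :
  gauss (A ++ p :: B ++ q :: C) -> lab q = lab p -> q = mate p.
Proof.
move=> gw lq; have /andP[uw /allP mw] := gw.
have pw : p \in A ++ p :: B ++ q :: C by rewrite mem_cat inE eqxx orbT.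
have qw : q \in A ++ p :: B ++ q :: C.
  by rewrite mem_cat inE mem_cat inE eqxx !orbT.
apply: (gauss_fst_inj gw) => //; first exact: mw.
have npq : p.1 != q.1.
  move: uw; rewrite map_cat cat_uniq => /and3P[_ _ /= /andP[]].
  by rewrite map_cat mem_cat inE !negb_or => /and3P[].
case: p q lq npq {gw pw qw uw mw} => [[x s] o] [[y r] o'].
rewrite /mate /lab /lft /ovr /= => ->; rewrite xpair_eqE eqxx /=.
by case: s; case: r.
Qed.

Lemma perm_two_out (T : eqType) (p q : T) A B C :
  perm_eq (A ++ p :: B ++ q :: C) (p :: q :: A ++ B ++ C).
Proof.
rewrite -cat1s perm_catCA /= perm_cons catA -cat1s perm_catCA /= perm_cons.
by rewrite catA.
Qed.

Lemma gauss_misses A B C p q :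
  gauss (A ++ p :: B ++ q :: C) -> lab q = lab p ->
  [/\ misses (lab p) A, misses (lab p) B & misses (lab p) C].
Proof.
move=> gw lq; have qE := gauss_mate gw lq.
have: misses (lab p) (A ++ B ++ C).
  apply/hasPn => r rw; apply/eqP => lr.
  have : r.1 = p.1 \/ r.1 = q.1.
    move: lr; rewrite qE; case: r {rw} => [[y t] o']; case: p {gw lq qE} =>
      [[x s] o].
    by rewrite /lab /mate /lft /= => ->; case: t; case: s; [left|right|right|left].
  have pm := perm_two_out p q A B C.
  have /andP[] := gw; rewrite (perm_uniq (perm_map _ pm)) /= => /and3P[].
  rewrite inE negb_or => /andP[_ np] nq _ _ [] er.
  - by case/negP: np; rewrite -er map_f.
  - by case/negP: nq; rewrite -er map_f.
by rewrite !misses_cat => /and3P[].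
Qed.

Lemma has_split x w :
  has (on x) w -> exists A p B, [/\ w = A ++ p :: B, lab p = x & misses x A].
Proof.
move=> hx; case: (split_find hx) => p A B /eqP lp nA.
by exists A, p, B; rewrite cat_rcons.
Qed.

Lemma mem_on x p w : p \in w -> lab p = x -> has (on x) w.
Proof. by move=> pw <-; apply/hasP; exists p; rewrite // /on. Qed.

Lemma gauss_split x w : gauss w -> has (on x) w ->
  exists A p B q C, [/\ w = A ++ p :: B ++ q :: C, lab p = x & lab q = x].
Proof.
move=> gw /has_split[A [p [B [wE lp mA]]]].
have /andP[_ /allP mw] := gw.
have pw : p \in w by rewrite wE mem_cat inE eqxx orbT.
have := mw p pw; rewrite wE mem_cat inE => /or3P[qA|/eqP/(congr1 lft)|qB].
- by have := mem_on qA lp; rewrite (negPf mA).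
- by rewrite lft_mate; case: (lft p).
by case/splitPr: qB wE => B1 C wE; exists A, p, B1, (mate p), C.
Qed.

Section Rotation.
Variable F : endpoint -> int -> int.
Hypothesis F_mate : forall p S, F (mate p) (- S) = F p S.

(** Seen from its second passage, a crossing has the opposite total shift, since the
    whole word has total shift 0; [F_mate] makes its term independent of this choice. *)
Lemma chord_sum_rot u v :
  gauss (u ++ v) -> chord_sum F (u ++ v) = chord_sum F (v ++ u).
Proof.
elim: u v => [|p u IH] v gw; first by rewrite cats0.
rewrite -[in RHS]cat1s catA -IH; last first.
  by rewrite catA -(gauss_perm (permEl (perm_catC [:: p] _))).
rewrite catA cat_cons in gw *; move: {IH} (u ++ v) gw => w gw.
have hp : has (on (lab p)) w.
  have /andP[_ /allP/(_ p (mem_head _ _))] := gw.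
  rewrite inE => /predU1P[/(congr1 lft)|/mem_on ->] //.
  by rewrite lft_mate; case: (lft p).
have [A [q [B [wE lq mA]]]] := has_split hp.
have gw' : gauss ([::] ++ p :: A ++ q :: B) by rewrite /= -wE.
have [_ _ mB] := gauss_misses gw' lq.
have qE := gauss_mate gw' lq.
have S0 := gauss_shift_sum gw'.
rewrite wE !chord_sumE !hits_back_misses ?lq // !hits_misses ?lq //.
rewrite ?lq !eqxx.
have -> : F q (shift_sum B + 0) = F p (0 + shift_sum A); last by ring.
rewrite qE -(F_mate p); congr F.
move: S0; rewrite !shift_sumE qE shift_mate.
by move=> e; rewrite -[LHS]subr0 -[X in _ - X]e; ring.
Qed.
End Rotation.

(** Reversing the orientation of a diagram changes the sign of its flat chord sums. *)
Lemma chord_sum_rev F (w : seq endpoint) :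
  (forall p q S, lab p = lab q -> lft p = ~~ lft q -> F p S = - F q S) ->
  uniq (map fst w) -> chord_sum F (rev w) = - chord_sum F w.
Proof.
move=> FN; elim: w => [|p w IH] /=; first by rewrite oppr0.
move=> /andP[pw uw]; rewrite rev_cons -cats1 !chord_sumE IH //.
have -> : forall S, hits_back F p S (rev w) = - hits F p S w; last by ring.
elim: w pw {IH uw} => [|q w IH] /=.
  by move=> _ S; rewrite oppr0.
rewrite inE negb_or => /andP[npq npw] S.
rewrite rev_cons -cats1 /hits_back cross_sum_catl.
rewrite -/(hits_back F p _ _) IH //.
rewrite /= !shift_sumE addr0 add0r [shift q + S]addrC eq_sym; case: eqP =>
  [lpq|_]; last by ring.
rewrite (FN q p) //; first by ring.
move: npq lpq; case: (p) => [[x s] o]; case: (q) => [[y t] o'].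
by rewrite /lab /lft /= => h e; move: h; rewrite e xpair_eqE eqxx; case: s; case: t.
Qed.

(** * Smoothing against orientation *)

(** Exchanges the sides of the passages with a label in [T]. *)
Definition toggle (T : pred nat) (p : endpoint) : endpoint :=
  (lab p, lft p (+) T (lab p), ovr p).

(** Labels met an odd number of times, that is once, by [B]. *)
Definition odd_in (B : seq endpoint) : pred nat := fun x => odd (count (on x) B).

(** The word of a smoothing, up to rotation: if the passages through c cut the closed
    word into the paths [B] and [C], then [B] is reversed and the crossings met once by
    [B] have exactly one of their strands reversed, which exchanges their sides. *)
Definition reverse_along (B C : seq endpoint) : seq endpoint :=
  map (toggle (odd_in B)) (rev B ++ C).

Lemma has_toggle T x w : has (on x) (map (toggle T) w) = has (on x) w.
Proof. by rewrite has_map; apply: eq_has. Qed.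

Lemma misses_toggle T x w : misses x (map (toggle T) w) = misses x w.
Proof. by rewrite /misses has_toggle. Qed.

Lemma misses_rev x w : misses x (rev w) = misses x w.
Proof. by rewrite /misses has_rev. Qed.

Lemma toggle_uniq T w : uniq (map fst w) -> uniq (map fst (map (toggle T) w)).
Proof.
move=> uw; rewrite -map_comp.
rewrite (_ : map _ w = map (fun s : nat * bool => (s.1, s.2 (+) T s.1))
  (map fst w)).
  rewrite map_inj_uniq // => -[x s] [y t] /= [-> e]; congr (_, _).
  exact: (addIb e).
by rewrite -map_comp.
Qed.

Lemma gauss_toggle T w : gauss w -> gauss (map (toggle T) w).
Proof.
case/andP=> uw /allP mw; rewrite /gauss toggle_uniq //=.
apply/allP => _ /mapP[p /mw pw ->]; apply/mapP; exists (mate p) => //.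
by rewrite /mate /toggle /lab /lft /ovr /= addNb.
Qed.

Lemma misses_count x w : misses x w -> count (on x) w = 0%N.
Proof. by rewrite /misses has_count -eqn0Ngt => /eqP. Qed.

(** A label occurs in a Gauss word twice or not at all. *)
Lemma gauss_even x w : gauss w -> ~~ odd (count (on x) w).
Proof.
move=> gw; case hx: (has (on x) w); last by rewrite misses_count // /misses hx.
have [A [p [B [q [C [wE lp lq]]]]]] := gauss_split gw hx; rewrite wE in gw *.
have [] := gauss_misses gw; rewrite ?lq // lp => mA mB mC.
by rewrite !count_cat /= count_cat /= !misses_count // /on lp lq eqxx.
Qed.

Section Flat.
Variable g : int -> int.
Hypothesis g_odd : forall S, g (- S) = - g S.

(** Weight of a passage that ignores the levels of the crossing. *)
Definition flat_weight (p : endpoint) (S : int) : int := shift p * g S.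

Lemma flat_mate p S : flat_weight (mate p) (- S) = flat_weight p S.
Proof. by rewrite /flat_weight shift_mate g_odd mulrNN. Qed.

Lemma flatN p q S : lab p = lab q -> lft p = ~~ lft q -> flat_weight p S =
  - flat_weight q S.
Proof. by rewrite /flat_weight /shift => _ ->; case: (lft q);
  rewrite ?mulN1r ?mul1r ?opprK. Qed.

Lemma flat0 p : flat_weight p 0 = 0.
Proof.
have := g_odd 0; rewrite oppr0 => /eqP; rewrite -addr_eq0 -mulr2n mulrn_eq0 /=.
by move/eqP => g0; rewrite /flat_weight g0 mulr0.
Qed.

(** Flat chord sum of the smoothing at a crossing that cuts the closed word into [B]
    and [C]. *)
Definition smooth_sum (B C : seq endpoint) : int :=
  chord_sum flat_weight (reverse_along B C).

Lemma gauss_two p q B C :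
  gauss (p :: B ++ q :: C) -> lab q = lab p ->
  forall x, odd (count (on x) B) = odd (count (on x) C).
Proof.
move=> gw lq x; have := gauss_even x gw; rewrite /= count_cat /= /on lq.
by rewrite !oddD; case: (odd (lab p == x)); case: (odd (count _ B)); case: (odd _).
Qed.

Lemma gauss_drop p q B C :
  gauss (p :: B ++ q :: C) -> lab q = lab p -> gauss (B ++ C).
Proof.
move=> gw lq; have qE := gauss_mate (A := [::]) gw lq.
have pm := perm_two_out p q [::] B C.
have := gw; rewrite (gauss_perm pm) => gw1.
have := gauss_uniq gw1; rewrite /= inE negb_or => /and3P[/andP[_ npBC] nqBC _].
case/andP: gw1 => /= /and3P[_ _ uBC] /and3P[_ _ /allP mBC]; apply/andP; split=> //.
apply/allP => r rBC; have := mBC r rBC; rewrite !inE => /or3P[/eqP e|/eqP e|//].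
- by rewrite qE -e mateK rBC in nqBC.
- by rewrite -[p]mateK -qE -e mateK rBC in npBC.
Qed.

(** Reversing [C] instead of [B] amounts to reversing the whole smoothed word. *)
Lemma smooth_sumC p q B C :
  gauss (p :: B ++ q :: C) -> lab q = lab p ->
  smooth_sum C B = - smooth_sum B C.
Proof.
move=> gw lq; have oBC := gauss_two gw lq.
have /andP[uBC _] := gauss_drop gw lq.
rewrite -chord_sum_rev; last first.
- apply: toggle_uniq; rewrite (perm_uniq (perm_map fst (_ : perm_eq _ (B ++ C))))
  //.
  by rewrite perm_cat2r perm_rev.
- exact: flatN.
rewrite /smooth_sum /reverse_along -map_rev rev_cat revK; congr chord_sum.
by apply: eq_map => r; rewrite /toggle /odd_in oBC.
Qed.

(** The paths into which the passages with label [x] cut the closed word: [between]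
    follows the first passage, [outside] the second one. *)
Definition between (x : nat) (w : seq endpoint) : seq endpoint :=
  let w1 := drop (find (on x) w).+1 w in take (find (on x) w1) w1.
Definition outside (x : nat) (w : seq endpoint) : seq endpoint :=
  let w1 := drop (find (on x) w).+1 w in
  drop (find (on x) w1).+1 w1 ++ take (find (on x) w) w.

Lemma find_on x A p B : misses x A -> lab p = x ->
  find (on x) (A ++ p :: B) = size A.
Proof.
by move=> mA lp; rewrite find_cat (negPf mA) /= /on lp eqxx addn0.
Qed.

Lemma between_outside x A p B q C :
  misses x A -> lab p = x -> misses x B -> lab q = x ->
  between x (A ++ p :: B ++ q :: C) = B /\
  outside x (A ++ p :: B ++ q :: C) = C ++ A.
Proof.
move=> mA lp mB lq; rewrite /between /outside find_on //.
rewrite -cat_rcons drop_size_cat ?size_rcons // find_on // take_size_cat //.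
by rewrite -cat_rcons drop_size_cat ?size_rcons // cat_rcons take_size_cat.
Qed.

(** Absolute value of the flat chord sum of the smoothing at [x]. Unlike the sum
    itself, it does not depend on the base point. *)
Definition abs_smoothing (x : nat) (w : seq endpoint) : int :=
  `|smooth_sum (between x w) (outside x w)|.

Lemma abs_smoothE A p B q C :
  gauss (A ++ p :: B ++ q :: C) -> lab q = lab p ->
  abs_smoothing (lab p) (A ++ p :: B ++ q :: C) = `|smooth_sum B (C ++ A)|.
Proof.
move=> gw lq; have [mA mB _] := gauss_misses gw lq; rewrite /abs_smoothing.
by have [-> ->] := between_outside C mA erefl mB lq.
Qed.

Lemma abs_smooth_rot x u v :
  gauss (u ++ v) -> has (on x) (u ++ v) ->
  abs_smoothing x (u ++ v) = abs_smoothing x (v ++ u).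
Proof.
elim: u v => [|p u IH] v gw hx; first by rewrite cats0.
have gw1 : gauss (u ++ rcons v p).
  by rewrite -cats1 catA -(gauss_perm (permEl (perm_catC [:: p] _))).
rewrite -cat_rcons -IH //; last first.
  by move: hx; rewrite !has_cat has_rcons /=; case: (on x p); case: (has _ u).
rewrite -rcons_cat; rewrite -rcons_cat in gw1.
rewrite cat_cons in gw hx *; move: {IH} (u ++ v) gw hx gw1 => w gw hx gw1.
have [A [r [B [q [C [wE lr lq]]]]]] := gauss_split gw hx.
rewrite -{}lr in lq hx *.
case: A wE => [|a A] /= [pE wE]; rewrite {}wE {p}pE in gw hx gw1 *.
  have eN : rcons (B ++ q :: C) r = B ++ q :: C ++ r :: [::].
    by rewrite rcons_cat rcons_cons -cats1.
  rewrite eN in gw1 *; rewrite (@abs_smoothE [::]) // cats0 -lq.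
  by rewrite abs_smoothE ?lq // (smooth_sumC gw) ?normrN.
rewrite rcons_cat rcons_cons rcons_cat rcons_cons in gw1 *.
rewrite abs_smoothE // -cat_cons abs_smoothE //.
by rewrite cat_rcons.
Qed.

End Flat.

(** * Counting crossings by their smoothings *)

Lemma gauss_count x w : gauss w -> (count (on x) w <= 2)%N.
Proof.
move=> gw; case hx: (has (on x) w); last by rewrite misses_count // /misses hx.
have [A [p [B [q [C [wE lp lq]]]]]] := gauss_split gw hx; rewrite wE in gw *.
have [] := gauss_misses gw; rewrite ?lq // lp => mA mB mC.
by rewrite !count_cat /= count_cat /= !misses_count // /on lp lq eqxx.
Qed.

Lemma count_misses x w : count (on x) w = 0%N -> misses x w.
Proof. by move=> c0; rewrite /misses has_count c0. Qed.

Lemma gauss_has A p B : gauss (A ++ p :: B) -> has (on (lab p)) (A ++ B).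
Proof.
move=> gw; have := gauss_even (lab p) gw.
rewrite count_cat /= /on eqxx has_count -/(on _) count_cat addnCA /= negbK.
by rewrite lt0n; apply: contraL => /eqP ->.
Qed.

Lemma shift_toggle T p :
  shift (toggle T p) = if T (lab p) then - shift p else shift p.
Proof. by rewrite /shift /toggle /lft /=; case: p.1.2; case: (T _). Qed.

Lemma lab_toggle T p : lab (toggle T p) = lab p. Proof. by []. Qed.

Lemma eq_in_toggle B B' : perm_eq B B' -> toggle (odd_in B) =1 toggle (odd_in B').
Proof.
by move=> BB' p; rewrite /toggle /odd_in (permP BB').
Qed.

Lemma chord_sum_map2 (T : eqType) F F' (f f' : T -> endpoint) w :
  (forall p S, p \in w -> F' (f' p) S = F (f p) S) ->
  {in w, forall p, shift (f' p) = shift (f p)} ->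
  {in w &, forall p q, (lab (f' p) == lab (f' q)) = (lab (f p) == lab (f q))} ->
  chord_sum F' (map f' w) = chord_sum F (map f w).
Proof.
elim: w => //= p w IH fF fs fl; rewrite IH; first last.
- by move=> q r qw rw; apply: fl; rewrite inE ?qw ?rw orbT.
- by move=> q qw; apply: fs; rewrite inE qw orbT.
- by move=> q S qw; apply: fF; rewrite inE qw orbT.
congr (_ + _); have pw : p \in p :: w by rewrite mem_head.
suff: forall v S, {subset v <= p :: w} ->
    hits F' (f' p) S (map f' v) = hits F (f p) S (map f v).
  by apply=> q qw; rewrite inE qw orbT.
elim=> //= q v IHv S vw.
have qw : q \in p :: w by apply: vw; rewrite mem_head.
rewrite fs // fl // fF // IHv // => r rv.
by apply: vw; rewrite inE rv orbT.
Qed.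

Lemma chord_sum_map F F' f w :
  (forall p S, p \in w -> F' (f p) S = F p S) ->
  {in w, forall p, shift (f p) = shift p} ->
  {in w &, forall p q, (lab (f p) == lab (f q)) = (lab p == lab q)} ->
  chord_sum F' (map f w) = chord_sum F w.
Proof. by move=> *; rewrite -[w in RHS]map_id; apply: chord_sum_map2. Qed.

Section Flat.
Variable g : int -> int.
Hypothesis g_odd : forall S, g (- S) = - g S.

Local Notation flat := (flat_weight g).
Local Notation abs_smooth := (abs_smoothing g).

(** Sum of the signs of the crossings whose smoothing has flat chord sum [k] or [- k].
    The sign of a crossing is minus the shift of its overcrossing. *)
Definition smoothing_count (k : int) (w : seq endpoint) : int :=
  \sum_(p <- w | ovr p && (abs_smooth (lab p) w == k)) - shift p.

Lemma smooth_count_perm k w w' :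
  perm_eq w w' ->
  (forall x, has (on x) w -> abs_smooth x w = abs_smooth x w') ->
  smoothing_count k w = smoothing_count k w'.
Proof.
move=> pww' sm; rewrite /smoothing_count -(perm_big _ pww') /=.
rewrite big_seq_cond [RHS]big_seq_cond; apply: eq_bigl => p.
by case: (boolP (p \in w)) => //= pw; rewrite sm // (mem_on pw).
Qed.

Lemma smooth_count_rot k u v :
  gauss (u ++ v) -> smoothing_count k (u ++ v) = smoothing_count k (v ++ u).
Proof.
move=> gw; apply: smooth_count_perm => [|x hx]; first by rewrite perm_catC.
exact: abs_smooth_rot.
Qed.

(** The kink survives in the smoothing at another crossing. *)
Lemma abs_smooth_kink x a b Y :
  gauss ([:: a; b] ++ Y) -> gauss Y -> lab b = lab a -> has (on x) Y ->
  abs_smooth x ([:: a; b] ++ Y) = abs_smooth x Y.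
Proof.
move=> gT gY lb hx; have [mY _ _] := gauss_misses (A := [::]) (B := [::]) gT lb.
have [_ _ {}mY] := gauss_misses (A := [::]) (B := [::]) gT lb.
have bE := gauss_mate (A := [::]) (B := [::]) gT lb.
have [A [p [B [q [C [YE lp lq]]]]]] := gauss_split gY hx.
rewrite YE in gT gY mY *; rewrite -{}lp in lq *.
rewrite catA !abs_smoothE // -?catA // /smooth_sum /reverse_along.
congr (`|_|); rewrite !catA !map_cat -!catA.
move: mY; rewrite misses_cat misses_cons misses_cat misses_cons.
move=> /and5P[mA _ mB _ mC]; rewrite catA [in RHS]catA.
rewrite [map _ [:: a; b]]/= chord_sum_kink //.
- by rewrite !shift_toggle lb bE shift_mate; case: ifP.
- by rewrite lab_toggle !misses_cat !misses_toggle misses_rev mB mC mA.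
- exact: flat0.
Qed.

(** Smoothing at the crossing of the kink gives back the word without the kink. *)
Lemma smooth_count_kink k a b Y :
  gauss ([:: a; b] ++ Y) -> gauss Y -> lab b = lab a ->
  `|chord_sum flat Y| != k ->
  smoothing_count k ([:: a; b] ++ Y) = smoothing_count k Y.
Proof.
move=> gT gY lb nk; rewrite /smoothing_count.
have sa : abs_smooth (lab a) ([:: a; b] ++ Y) = `|chord_sum flat Y|.
  have := abs_smoothE g (A := [::]) (B := [::]) gT lb.
  rewrite /smooth_sum /reverse_along /= cats0 => ->; congr (`|chord_sum _ _|).
  rewrite -[RHS]map_id; apply: eq_map => -[[y s] o].
  by rewrite /toggle /odd_in /= addbF.
rewrite big_cat /= !big_cons big_nil lb sa (negPf nk) !andbF !add0r.
rewrite big_seq_cond [RHS]big_seq_cond; apply: eq_bigl => p.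
case: (boolP (p \in Y)) => //= pY.
by rewrite -[a :: b :: Y]/([:: a; b] ++ Y) abs_smooth_kink // (mem_on pY).
Qed.

End Flat.

(** * Bigons *)

Lemma misses_of_count x w n :
  (count (on x) w + n <= 2)%N -> (2 <= n)%N -> misses x w.
Proof.
move=> le2 ge2; apply: count_misses; apply/eqP; rewrite -leqn0.
by rewrite -(leq_add2r n) add0n (leq_trans le2).
Qed.

(** The strands [P] and [Q] of a bigon with vertices [x] and [y]. *)
Inductive bigon x y : seq endpoint -> seq endpoint -> Prop :=
  Bigon (d : bool) a b a' b' of x != y
    & lab a = x & lab b = y & lab a' = x & lab b' = y
    & shift b = - shift a & shift a' = - shift a & shift b' = shift a :
  bigon x y [:: a; b] (if d then [:: a'; b'] else [:: b'; a']).

Lemma bigon_revl x y P Q : bigon x y P Q -> bigon y x (rev P) Q.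
Proof.
case=> d a b a' b' nxy la lb la' lb' sb sa' sb'.
have -> : (if d then [:: a'; b'] else [:: b'; a']) =
          if ~~ d then [:: b'; a'] else [:: a'; b'] by case: d.
by apply: Bigon; rewrite // 1?eq_sym ?sb ?sa' ?sb' ?opprK.
Qed.

Lemma bigon_sym x y P Q :
  bigon x y P Q -> bigon x y Q P \/ bigon y x Q P.
Proof.
case=> d a b a' b' nxy la lb la' lb' sb sa' sb'.
case: d; [left; apply: (Bigon true)|right; apply: (Bigon false)];
  by rewrite // 1?eq_sym ?sb ?sa' ?sb' ?opprK.
Qed.

Lemma bigon_toggle T x y P Q : T x = T y ->
  bigon x y P Q -> bigon x y (map (toggle T) P) (map (toggle T) Q).
Proof.
move=> Txy; case=> d a b a' b' nxy la lb la' lb' sb sa' sb'.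
rewrite (fun_if (map (toggle T))) /=.
by apply: Bigon; rewrite // !shift_toggle ?la ?lb ?la' ?lb' ?sb ?sa' ?sb' ?Txy;
  case: ifP.
Qed.

Lemma bigon_count x y P Q : bigon x y P Q ->
  [/\ count (on x) P = 1%N, count (on x) Q = 1%N,
      count (on y) P = 1%N & count (on y) Q = 1%N].
Proof.
case=> d a b a' b' nxy la lb la' lb' _ _ _; have nyx : y != x by rewrite eq_sym.
by case: d; rewrite /= /on la lb la' lb' !eqxx (negPf nxy) (negPf nyx).
Qed.

Lemma bigon_other x y P Q w z : bigon x y P Q ->
  misses x w -> misses y w -> has (on z) w -> misses z Q.
Proof.
case=> d a b a' b' nxy la lb la' lb' _ _ _ mx my hz.
have zx : (x == z) = false by apply: contraNF mx => /eqP ->.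
have zy : (y == z) = false by apply: contraNF my => /eqP ->.
by case: d; rewrite /misses /= /on la' lb' zx zy.
Qed.

Lemma bigon_strands x y P Q : bigon x y P Q ->
  [/\ shift_sum P = 0, shift_sum Q = 0,
      {in P, forall p, lab p = x \/ lab p = y} &
      {in Q, forall p, lab p = x \/ lab p = y}].
Proof.
case=> d a b a' b' nxy la lb la' lb' sb sa' sb'; split.
- by rewrite !shift_sumE sb addr0 subrr.
- by case: d; rewrite !shift_sumE sb' sa' addr0 ?subrr ?addNr.
- by move=> p; rewrite !inE => /orP[]/eqP->; [left|right].
- by case: d => p; rewrite !inE => /orP[]/eqP->; [left|right|right|left].
Qed.

Lemma bigon_misses x y P Q X Y Z : bigon x y P Q ->
  gauss (X ++ P ++ Y ++ Q ++ Z) ->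
  [/\ misses x X, misses x Y & misses x Z] /\
  [/\ misses y X, misses y Y & misses y Z].
Proof.
move=> PQ gT; have [xP xQ yP yQ] := bigon_count PQ.
split; [have := gauss_count x gT | have := gauss_count y gT];
  rewrite !count_cat ?xP ?xQ ?yP ?yQ => le2; split;
  apply: (@misses_of_count _ _ 2) => //; apply: leq_trans le2; lia.
Qed.

Lemma chord_sum_bigon_out F x y P Q u v w :
  (forall p q S, p \in P -> q \in P -> shift q = - shift p ->
     F p S + F q S = 0) ->
  bigon x y P Q -> misses x (u ++ v ++ w) -> misses y (u ++ v ++ w) ->
  chord_sum F (u ++ P ++ v ++ Q ++ w) = chord_sum F (u ++ v ++ w).
Proof.
move=> FN PQ mx my; case: PQ FN => d a b a' b' nxy la lb la' lb' sb sa' sb' FN.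
apply: chord_sum_bigon; rewrite ?la ?lb //; first by rewrite eq_sym.
by move=> S; apply: FN; rewrite ?inE ?eqxx ?orbT.
Qed.

(** A kink that contains the base point. *)
Lemma chord_sum_ends F p q w :
  lab q = lab p -> misses (lab p) w -> shift_sum w = 0 -> F p 0 = 0 ->
  chord_sum F (p :: w ++ [:: q]) = chord_sum F w.
Proof.
move=> lq mw w0 F0; have mq : misses (lab q) w by rewrite lq.
rewrite !chord_sumE !hits_back_misses // !hits_misses // lq eqxx w0 addr0 F0.
ring.
Qed.

(** Up to rotation the two words are the same, with [q'] and [p'] in place of [p] and
    [q]. *)
Lemma chord_sum_exchange F p q p' q' u v :
  lab q = lab p -> lab q' = lab p' ->
  misses (lab p) (u ++ v) -> misses (lab p') (u ++ v) ->
  shift p' = shift q -> F p' (shift_sum v) = F p (shift_sum u) ->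
  chord_sum F (p :: u ++ q :: v) = chord_sum F (u ++ p' :: v ++ [:: q']).
Proof.
move=> lq lq'; rewrite !misses_cat => /andP[mu mv] /andP[mu' mv'] sq Fq.
have [qu qv] : misses (lab q) u /\ misses (lab q) v by rewrite lq.
have [qu' qv'] : misses (lab q') u /\ misses (lab q') v by rewrite lq'.
rewrite !chord_sumE !hits_back_misses // !hits_misses // lq lq' !eqxx.
rewrite !add0r !addr0 sq Fq; ring.
Qed.

Lemma on_misses x p q w : misses x w -> p \in w -> lab q = x ->
  on (lab p) q = false.
Proof.
move=> mw pw lq; apply/negP; rewrite /on lq => /eqP lp.
by case/negP: mw; apply: mem_on pw _.
Qed.

Lemma map_toggle_eq B B' w :
  {in w, forall p, odd (count (on (lab p)) B) = odd (count (on (lab p)) B')} ->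
  map (toggle (odd_in B)) w = map (toggle (odd_in B')) w.
Proof. by move=> BB; apply/eq_in_map => p pw; rewrite /toggle /odd_in BB. Qed.

Lemma cat_eq_split (T : Type) (X Y A B : seq T) p : A ++ p :: B = X ++ Y ->
  (exists X2, X = A ++ p :: X2 /\ B = X2 ++ Y) \/
  (exists Y1, A = X ++ Y1 /\ Y = Y1 ++ p :: B).
Proof.
elim: X A => [|x X IH] [|a A] /=; first by move=> <-; right; exists [::].
- by move=> <-; right; exists (a :: A).
- by case=> <- ->; left; exists X.
case=> <- /IH[[X2 [-> ->]]|[Y1 [-> ->]]]; first by left; exists X2.
by right; exists Y1.
Qed.

Section Flat.
Variable g : int -> int.
Hypothesis g_odd : forall S, g (- S) = - g S.

Local Notation flat := (flat_weight g).
Local Notation abs_smooth := (abs_smoothing g).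
Local Notation smooth_count := (smoothing_count g).

Lemma flat_bigon p q S : shift q = - shift p -> flat p S + flat q S = 0.
Proof. by rewrite /flat_weight => ->; rewrite mulNr subrr. Qed.

(** The smoothings at the two vertices of a bigon agree. *)
Lemma abs_smooth_bigon_pair x y P X Q Y : bigon x y P Q ->
  gauss (P ++ X ++ Q ++ Y) -> gauss (X ++ Y) ->
  abs_smooth x (P ++ X ++ Q ++ Y) = abs_smooth y (P ++ X ++ Q ++ Y).
Proof.
move=> PQ gT gXY; have := bigon_misses (X := [::]) PQ gT.
case: PQ gT => d a b a' b' nxy la lb la' lb' sb sa' sb'.
have nyx : (y == x) = false by apply/negbTE; rewrite eq_sym.
move=> gT [[_ xX xY] [_ yX yY]].
have xXY : misses x (rev X ++ Y) by rewrite misses_cat misses_rev xX xY.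
have yXY : misses y (rev X ++ Y) by rewrite misses_cat misses_rev yX yY.
have gXY' T : gauss (map (toggle T) (rev X ++ Y)).
  apply: gauss_toggle; rewrite (gauss_perm (w' := X ++ Y)) //.
  by rewrite perm_cat2r perm_rev.
rewrite -{1}la -{1}lb.
case: d gT => gT.
- (* Both smoothings leave a kink, whose removal gives the same word. *)
  transitivity `|chord_sum flat (reverse_along X Y)|; [|symmetry].
    rewrite (abs_smoothE g (A := [::]) (B := b :: X) (C := b' :: Y)) ?la //.
    rewrite cats0 /smooth_sum /reverse_along rev_cons -cats1 -!catA.
    rewrite map_cat [map _ ([:: b] ++ _)]/= -[_ :: _ :: _]/([:: _; _] ++ _).
    rewrite (chord_sum_kink (u := map _ _) (v := map _ Y)).
    + rewrite -map_cat (map_toggle_eq (B' := X)) // => p pXY /=.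
      by rewrite (on_misses yXY pXY lb).
    + by rewrite !lab_toggle lb lb'.
    + by rewrite !shift_toggle lb lb' sb sb'; case: ifP; rewrite ?opprK.
    + by rewrite -map_cat misses_toggle lab_toggle lb.
    + exact: flat0.
  have := @abs_smoothE g [:: a] b (X ++ [:: a']) b' Y.
  rewrite /= -catA /= => -> //; last by rewrite lb.
  rewrite /smooth_sum /reverse_along [in rev _]cats1 rev_rcons cat_cons catA
    map_cons map_cat [map _ [:: a]]/= chord_sum_ends.
  + rewrite (map_toggle_eq (B' := X)) // => p pXY.
    by rewrite count_cat /= (on_misses xXY pXY la') !addn0.
  + by rewrite !lab_toggle la la'.
  + by rewrite misses_toggle lab_toggle la'.
  + by rewrite gauss_shift_sum.
  + exact: flat0.
- (* Both smoothings leave one crossing: the other vertex, turned round. *)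
  have := @abs_smoothE g [::] a (b :: X ++ [:: b']) a' Y.
  rewrite /= -catA cats0 /= => -> //; last by rewrite la.
  rewrite (abs_smoothE g (A := [:: a]) (B := X) (C := a' :: Y)) ?lb //.
  rewrite /smooth_sum /reverse_along.
  have -> : rev (b :: X ++ [:: b']) ++ Y = b' :: rev X ++ b :: Y.
    by rewrite rev_cons cats1 rev_rcons -cats1 /= -catA.
  rewrite (map_toggle_eq (B' := X)); last first.
    move=> p pw /=; rewrite count_cat /= addn0.
    have [lp|lp] := eqVneq (lab p) y.
      by rewrite /on lb lb' lp eqxx addnC addn1 -addSnnS addn0 /= negbK.
    by rewrite /on lb lb' eq_sym (negPf lp) addn0.
  rewrite map_cons map_cat map_cons [in RHS]map_cat map_cat
    [map _ (a' :: Y)]map_cons.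
  rewrite [map _ [:: a]]/= cat_cons.
  have sXY := gauss_shift_sum (gXY' (odd_in X)).
  rewrite map_cat shift_sum_cat in sXY.
  have Xx : odd_in X x = false by rewrite /odd_in misses_count.
  have Xy : odd_in X y = false by rewrite /odd_in misses_count.
  congr (`|_|); apply: chord_sum_exchange.
  + by rewrite !lab_toggle lb lb'.
  + by rewrite !lab_toggle la la'.
  + by rewrite lab_toggle lb' -map_cat misses_toggle.
  + by rewrite lab_toggle la' -map_cat misses_toggle.
  + by rewrite !shift_toggle la' lb Xx Xy sa' sb.
  + rewrite /flat_weight !shift_toggle la' lb' Xx Xy sa' sb'.
    by rewrite -(addr0_eq sXY) g_odd mulrNN.
Qed.

(** The bigon survives in the smoothing at another crossing. *)
Lemma reverse_along_bigon x y P Q X Y c :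
  bigon x y P Q -> gauss (P ++ X ++ Q ++ Y) -> gauss (X ++ Y) ->
  has (on c) (X ++ Y) ->
  abs_smooth c (P ++ X ++ Q ++ Y) = abs_smooth c (X ++ Y).
Proof.
move=> PQ gT gXY hc.
have [[_ xX xY] [_ yX yY]] := bigon_misses (X := [::]) PQ gT.
have [xP xQ yP yQ] := bigon_count PQ.
have out T u Q' v P' w : T x = T y -> bigon x y Q' P' \/ bigon y x Q' P' ->
    misses x (u ++ v ++ w) -> misses y (u ++ v ++ w) ->
    chord_sum flat (map (toggle T) (u ++ Q' ++ v ++ P' ++ w)) =
    chord_sum flat (map (toggle T) (u ++ v ++ w)).
  move=> Txy bQP mx my; rewrite !map_cat.
  have mx' := misses_toggle T x (u ++ v ++ w).
  have my' := misses_toggle T y (u ++ v ++ w).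
  rewrite !map_cat in mx' my'.
  case: bQP => bg; [have b := bigon_toggle Txy bg
                   | have b := bigon_toggle (esym Txy) bg];
    by apply: (chord_sum_bigon_out _ b); rewrite ?mx' ?my' // => *;
      apply: flat_bigon.
have [A [p [B [q [C [XYE lp lq]]]]]] := gauss_split gXY hc.
rewrite -{}lp in hc lq *.
case: (cat_eq_split (esym XYE)) => [[X2 [XE CE2]]|[A2 [AE YE]]]; last first.
- rewrite {}YE {AE XYE hc} -?catA in gT gXY xY yY *.
  rewrite catA in gXY; have := abs_smoothE g gXY lq; rewrite -!catA => ->.
  have := @abs_smoothE g (P ++ X ++ Q ++ A2) p B q C.
  rewrite -!catA => -> //.
  move: xY yY; rewrite !(misses_cat, misses_cons).
  move=> /and5P[xA _ xB _ xC] /and5P[yA _ yB _ yC].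
  congr (`|_|); rewrite /smooth_sum /reverse_along.
  have := out (odd_in B) (rev B ++ C) P X Q A2; rewrite -!catA => -> //.
  + by rewrite /odd_in !misses_count.
  + by left.
  + by rewrite !misses_cat misses_rev xB xC xX xA.
  + by rewrite !misses_cat misses_rev yB yC yX yA.
case: (cat_eq_split CE2) => [[C1 [X2E CE]]|[B2 [BE YE]]].
- rewrite {}X2E {CE2} in XE; rewrite {}XE {CE XYE hc} in gT gXY xX yX *.
  move: xX yX; rewrite !(misses_cat, misses_cons).
  move=> /and5P[xA _ xB _ xC] /and5P[yA _ yB _ yC].
  rewrite -!catA /= -!catA /= in gT gXY *.
  rewrite (abs_smoothE g gXY) //.
  have := @abs_smoothE g (P ++ A) p B q (C1 ++ Q ++ Y).
  rewrite -!catA => -> //.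
  congr (`|_|); rewrite /smooth_sum /reverse_along.
  have := out (odd_in B) (rev B ++ C1) Q Y P A; rewrite -!catA => -> //.
  + by rewrite /odd_in !misses_count.
  + exact: bigon_sym.
  + by rewrite !misses_cat misses_rev xA xB xC xY.
  + by rewrite !misses_cat misses_rev yA yB yC yY.
clear BE CE2 XYE hc; rewrite {}XE {}YE in gT gXY xX yX xY yY *.
move: xX yX xY yY; rewrite !(misses_cat, misses_cons).
move=> /and3P[xA _ xB] /and3P[yA _ yB] /and3P[xB2 _ xC] /and3P[yB2 _ yC].
have := @abs_smoothE g A p (X2 ++ B2) q C; rewrite -!catA /= => eXY.
rewrite -!catA /= in gT gXY *; rewrite eXY //.
have := @abs_smoothE g (P ++ A) p (X2 ++ Q ++ B2) q C.
rewrite -!catA /= -?catA => -> //.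
congr (`|_|); rewrite /smooth_sum /reverse_along.
have := out (odd_in (X2 ++ Q ++ B2)) (rev B2) (rev Q) (rev X2 ++ C) P A.
rewrite !rev_cat -!catA => -> //.
+ rewrite (map_toggle_eq (B' := X2 ++ B2)) // => r rw.
  rewrite !count_cat [count _ Q]misses_count ?addn0 //.
  apply: (bigon_other (w := rev B2 ++ rev X2 ++ C ++ A) PQ).
  * by rewrite !misses_cat !misses_rev xA xB xB2 xC.
  * by rewrite !misses_cat !misses_rev yA yB yB2 yC.
  * exact: mem_on rw _.
+ by rewrite /odd_in !count_cat xQ yQ !misses_count.
+ by case: (bigon_sym PQ) => /bigon_revl; [right|left].
+ by rewrite !misses_cat !misses_rev xA xB xB2 xC.
+ by rewrite !misses_cat !misses_rev yA yB yB2 yC.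
Qed.

(** The vertices of a bigon have opposite signs. *)
Lemma smooth_count_bigon k x y P X Q Y l :
  bigon x y P Q -> gauss (P ++ X ++ Q ++ Y) -> gauss (X ++ Y) ->
  {in P, forall p, ovr p = l} -> {in Q, forall q, ovr q = ~~ l} ->
  smooth_count k (P ++ X ++ Q ++ Y) = smooth_count k (X ++ Y).
Proof.
move=> PQ gT gXY ovP ovQ; rewrite /smoothing_count.
have pm : perm_eq (P ++ X ++ Q ++ Y) ((P ++ Q) ++ (X ++ Y)).
  by rewrite -catA perm_cat2l perm_catCA.
set T := P ++ X ++ Q ++ Y; rewrite (perm_big _ pm) big_cat /= big_cat /=.
have strand0 S l' : {in S, forall p, ovr p = l'} -> shift_sum S = 0 ->
    {in S, forall p, lab p = x \/ lab p = y} ->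
    \sum_(p <- S | ovr p && (abs_smooth (lab p) T == k)) - shift p = 0.
  move=> ovS S0 xyS; rewrite big_seq_cond.
  rewrite (eq_bigl (fun p => (p \in S) && (l' && (abs_smooth x T == k)))).
    rewrite -big_seq_cond; case: (l' && _); last by rewrite big_pred0.
    by rewrite sumrN -/(shift_sum S) S0 oppr0.
  move=> p; case: (boolP (p \in S)) => //= pS; rewrite ovS //.
  by case: (xyS p pS) => ->; rewrite // -(abs_smooth_bigon_pair PQ).
have [P0 Q0 PL QL] := bigon_strands PQ.
rewrite (strand0 P l) // (strand0 Q (~~ l)) // !add0r.
rewrite big_seq_cond [RHS]big_seq_cond; apply: eq_bigl => p.
case: (boolP (p \in X ++ Y)) => //= pXY; rewrite /T.
by rewrite (reverse_along_bigon PQ) // (mem_on pXY).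
Qed.

End Flat.

(** * Triangles *)

Lemma map_directed (S T : Type) (f : S -> T) e w :
  map f (directed e w) = directed e (map f w).
Proof. by case: e; rewrite //= map_rev. Qed.

Lemma rev_directed (T : Type) e (w : seq T) :
  rev (directed e w) = directed (~~ e) w.
Proof. by case: e; rewrite //= revK. Qed.

Lemma perm_directed (T : eqType) e e' (w : seq T) :
  perm_eq (directed e w) (directed e' w).
Proof.
by case: e; case: e'; rewrite //= ?perm_rev // perm_sym perm_rev.
Qed.

Lemma lft_toggle T p : lft (toggle T p) = lft p (+) T (lab p). Proof. by []. Qed.

(** [P], [Q], [R] are the strands 1, 2, 3 of a triangle, met in this cyclic order;
    [P'], [Q'], [R'] are the strands once moved across it. The vertices are [x] on
    strands 1 and 2, [y] on 2 and 3, [z] on 3 and 1, and [ei] tells whether strand i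
    follows the cyclic order of the vertices. The sides are determined by
    [e1], [e2], [e3] up to the sign [k], which tells whether that cyclic order is
    counterclockwise. *)
Inductive triangle_flip x y z :
    seq endpoint -> seq endpoint -> seq endpoint ->
    seq endpoint -> seq endpoint -> seq endpoint -> Prop :=
  TriangleFlip k e1 e2 e3 z1 x1 x2 y2 y3 z3 of
    [/\ x != y, y != z & z != x]
  & [/\ lab x1 = x, lab x2 = x, lab y2 = y & lab y3 = y] & lab z3 = z /\ lab z1 = z
  & lft x1 = (e1 (+) e2) (+) k /\ lft x2 = ~~ (e1 (+) e2) (+) k
  & lft y2 = (e2 (+) e3) (+) k /\ lft y3 = ~~ (e2 (+) e3) (+) k
  & lft z3 = (e3 (+) e1) (+) k /\ lft z1 = ~~ (e3 (+) e1) (+) k :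
  triangle_flip x y z
    (directed e1 [:: z1; x1]) (directed e2 [:: x2; y2])
    (directed e3 [:: y3; z3])
    (directed (~~ e1) [:: z1; x1]) (directed (~~ e2) [:: x2; y2])
    (directed (~~ e3) [:: y3; z3]).

Lemma triangle_rot x y z P Q R P' Q' R' :
  triangle_flip x y z P Q R P' Q' R' -> triangle_flip y z x Q R P Q' R' P'.
Proof.
case=> k e1 e2 e3 z1 x1 x2 y2 y3 z3 [xy yz zx] [lx1 lx2 ly2 ly3] [lz3 lz1].
by move=> [sx1 sx2] [sy2 sy3] [sz3 sz1]; apply: (TriangleFlip (k := k)).
Qed.

(** Reversing strand 1 exchanges the sides at its vertices [z] and [x]. *)
Lemma triangle_reverse (T : pred nat) x y z P Q R P' Q' R' :
  triangle_flip x y z P Q R P' Q' R' -> T x -> ~~ T y -> T z ->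
  triangle_flip x y z
    (map (toggle T) (rev P)) (map (toggle T) Q) (map (toggle T) R)
    (map (toggle T) (rev P')) (map (toggle T) Q') (map (toggle T) R').
Proof.
case=> k e1 e2 e3 z1 x1 x2 y2 y3 z3 xyz [lx1 lx2 ly2 ly3] [lz3 lz1].
move=> [sx1 sx2] [sy2 sy3] [sz3 sz1] Tx /negbTE Ty Tz.
rewrite !rev_directed !map_directed /=.
apply: (TriangleFlip (k := k)) => //; rewrite ?lft_toggle;
  rewrite ?lx1 ?lx2 ?ly2 ?ly3 ?lz3 ?lz1 ?Tx ?Ty ?Tz ?sx1 ?sx2 ?sy2 ?sy3 ?sz3 ?sz1.
all: by case: (e1); case: (e2); case: (e3); case: (k).
Qed.

Lemma triangle_toggle (T : pred nat) x y z P Q R P' Q' R' :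
  triangle_flip x y z P Q R P' Q' R' -> ~~ T x -> ~~ T y -> ~~ T z ->
  triangle_flip x y z
    (map (toggle T) P) (map (toggle T) Q) (map (toggle T) R)
    (map (toggle T) P') (map (toggle T) Q') (map (toggle T) R').
Proof.
case=> k e1 e2 e3 z1 x1 x2 y2 y3 z3 xyz [lx1 lx2 ly2 ly3] [lz3 lz1].
move=> [sx1 sx2] [sy2 sy3] [sz3 sz1] /negbTE Tx /negbTE Ty /negbTE Tz.
rewrite !map_directed /=.
apply: (TriangleFlip (k := k)) => //; rewrite ?lft_toggle;
  rewrite ?lx1 ?lx2 ?ly2 ?ly3 ?lz3 ?lz1 ?Tx ?Ty ?Tz ?sx1 ?sx2 ?sy2 ?sy3 ?sz3 ?sz1.
all: by case: (e1); case: (e2); case: (e3); case: (k).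
Qed.

Lemma triangle_perm x y z P Q R P' Q' R' :
  triangle_flip x y z P Q R P' Q' R' ->
  [/\ perm_eq P P', perm_eq Q Q' & perm_eq R R'].
Proof. by case=> *; split; apply: perm_directed. Qed.

Lemma count_directed a e (p q : endpoint) :
  count a (directed e [:: p; q]) = (a p + a q)%N.
Proof. by case: e; rewrite /= ?addn0 // addnC. Qed.

Lemma triangle_count x y z P Q R P' Q' R' :
  triangle_flip x y z P Q R P' Q' R' ->
  [/\ count (on x) P = 1%N, count (on x) Q = 1%N & count (on x) R = 0%N].
Proof.
case=> k e1 e2 e3 z1 x1 x2 y2 y3 z3 [xy yz zx] [lx1 lx2 ly2 ly3] [lz3 lz1] _ _ _.
rewrite !count_directed /on lx1 lx2 ly2 ly3 lz3 lz1 eqxx (negPf zx) eq_sym.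
by rewrite (negPf xy).
Qed.

Lemma triangle_misses x y z P Q R P' Q' R' u v w :
  triangle_flip x y z P Q R P' Q' R' ->
  gauss (P ++ u ++ Q ++ v ++ R ++ w) ->
  [/\ misses x u, misses x v & misses x w].
Proof.
move=> tr gT; have [xP xQ xR] := triangle_count tr.
have := gauss_count x gT; rewrite !count_cat xP xQ xR => le2.
by split; apply: (@misses_of_count _ _ 2) => //; apply: leq_trans le2; lia.
Qed.

(** Forgetting some crossings. *)
Lemma gauss_filter (a : pred nat) w :
  gauss w -> gauss [seq p <- w | a (lab p)].
Proof.
case/andP=> uw /allP mw; apply/andP; split.
  by apply: subseq_uniq uw; apply/map_subseq/filter_subseq.
by apply/allP => p; rewrite !mem_filter lab_mate => /andP[-> /mw].
Qed.

Lemma triangle_misses_all x y z P Q R P' Q' R' u v w :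
  triangle_flip x y z P Q R P' Q' R' ->
  gauss (P ++ u ++ Q ++ v ++ R ++ w) ->
  [/\ misses x (u ++ v ++ w), misses y (u ++ v ++ w) & misses z (u ++ v ++ w)].
Proof.
move=> tr gT.
have [xu xv xw] := triangle_misses tr gT.
have gT1 := gT; rewrite catA gauss_catC -!catA in gT1.
have tr1 := triangle_rot tr; have [yv yw yu] := triangle_misses tr1 gT1.
rewrite catA gauss_catC -!catA in gT1.
have tr2 := triangle_rot tr1; have [zw zu zv] := triangle_misses tr2 gT1.
by rewrite !misses_cat xu xv xw yu yv yw zu zv zw.
Qed.

Lemma triangle_labels x y z P Q R P' Q' R' :
  triangle_flip x y z P Q R P' Q' R' ->
  [/\ all (fun p => lab p \in [:: x; y; z]) P,
      all (fun p => lab p \in [:: x; y; z]) Q &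
      all (fun p => lab p \in [:: x; y; z]) R].
Proof.
case=> k e1 e2 e3 z1 x1 x2 y2 y3 z3 _ [lx1 lx2 ly2 ly3] [lz3 lz1] _ _ _.
by split; [case: (e1)|case: (e2)|case: (e3)];
  rewrite /= ?lx1 ?lx2 ?ly2 ?ly3 ?lz3 ?lz1 !inE !eqxx ?orbT.
Qed.

Lemma triangle_gauss x y z P Q R P' Q' R' u v w :
  triangle_flip x y z P Q R P' Q' R' ->
  gauss (P ++ u ++ Q ++ v ++ R ++ w) -> gauss (u ++ v ++ w).
Proof.
move=> tr gT; have [mx my mz] := triangle_misses_all tr gT.
have [PL QL RL] := triangle_labels tr.
have := gauss_filter (fun l => l \notin [:: x; y; z]) gT.
have out s : all (fun p => lab p \in [:: x; y; z]) s ->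
    [seq p <- s | lab p \notin [:: x; y; z]] = [::].
  by move=> sL; apply/eqP; rewrite -[_ == _]negbK -has_filter -all_predC;
    apply: sub_all sL => p /= ->.
have inn s : misses x s -> misses y s -> misses z s ->
    [seq p <- s | lab p \notin [:: x; y; z]] = s.
  move=> xs ys zs; apply/all_filterP/allP => p ps; rewrite !inE !negb_or.
  by apply/and3P; split; [move: xs|move: ys|move: zs];
    apply: contraNneq => lp; apply: mem_on ps _.
move: mx my mz; rewrite !misses_cat => /and3P[? ? ?] /and3P[? ? ?] /and3P[? ? ?].
by rewrite !filter_cat (out P) // (out Q) // (out R) // !inn.
Qed.

Lemma chord_sum_triangle_flip F x y z P Q R P' Q' R' t u v w :
  triangle_flip x y z P Q R P' Q' R' ->
  misses x (t ++ u ++ v ++ w) -> misses y (t ++ u ++ v ++ w) ->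
  misses z (t ++ u ++ v ++ w) ->
  chord_sum F (t ++ P ++ u ++ Q ++ v ++ R ++ w) =
  chord_sum F (t ++ P' ++ u ++ Q' ++ v ++ R' ++ w).
Proof.
case=> k e1 e2 e3 z1 x1 x2 y2 y3 z3 [xy yz zx] [lx1 lx2 ly2 ly3] [lz3 lz1].
move=> [sx1 sx2] [sy2 sy3] [sz3 sz1] mx my mz.
by apply: (@chord_sum_triangle F e1 e2 e3 k);
  rewrite ?lx1 ?lx2 ?ly2 ?ly3 ?lz3 ?lz1.
Qed.

Section Flat.
Variable g : int -> int.
Hypothesis g_odd : forall S, g (- S) = - g S.

Local Notation flat := (flat_weight g).
Local Notation abs_smooth := (abs_smoothing g).
Local Notation smooth_count := (smoothing_count g).

Lemma flatE p S : flat p S = shift p * g S. Proof. by []. Qed.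

(** Smoothing at a crossing whose passages leave the three strands on the same path. *)
Lemma abs_smooth_triangle_same c x y z P Q R P' Q' R' X Y Z :
  triangle_flip x y z P Q R P' Q' R' ->
  gauss (P ++ X ++ Q ++ Y ++ R ++ Z) -> gauss (P' ++ X ++ Q' ++ Y ++ R' ++ Z) ->
  has (on c) Z -> misses c (P ++ X ++ Q ++ Y ++ R) ->
  abs_smooth c (P ++ X ++ Q ++ Y ++ R ++ Z) =
  abs_smooth c (P' ++ X ++ Q' ++ Y ++ R' ++ Z).
Proof.
move=> tr gT gT' cZ mc.
have [mx my mz] := triangle_misses_all tr gT.
have [A [p [Z2 [ZE lp mA]]]] := has_split cZ;
rewrite -{}lp in cZ mc mA *; rewrite {}ZE in cZ gT gT' mx my mz *.
have cBC : has (on (lab p)) Z2.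
  have := @gauss_has (P ++ X ++ Q ++ Y ++ R ++ A) p Z2; rewrite -!catA => /(_ gT).
  move: mc mA; rewrite /misses !has_cat !negb_or.
  move=> /and5P[/negPf-> /negPf-> /negPf-> /negPf-> /negPf->] /negPf-> //.
have [B [q [C [Z2E lq mB]]]] := has_split cBC; rewrite {}Z2E in gT gT' mx my mz *.
have := @abs_smoothE g (P ++ X ++ Q ++ Y ++ R ++ A) p B q C; rewrite -!catA => ->
  //.
have := @abs_smoothE g (P' ++ X ++ Q' ++ Y ++ R' ++ A) p B q C; rewrite -!catA =>
  -> //.
move: mx my mz; rewrite !(misses_cat, misses_cons).
move=> /and5P[xX xY xA _ /and3P[xB _ xC]] /and5P[yX yY yA _ /and3P[yB _ yC]].
move=> /and5P[zX zY zA _ /and3P[zB _ zC]].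
congr (`|_|); rewrite /smooth_sum /reverse_along.
have tr' := triangle_toggle (T := odd_in B) tr.
rewrite [rev B ++ _]catA map_cat [in RHS]catA [in RHS]map_cat.
rewrite !(map_cat _ P) !(map_cat _ P') !(map_cat _ X) !(map_cat _ Q)
  !(map_cat _ Q') !(map_cat _ Y) !(map_cat _ R) !(map_cat _ R').
apply: (chord_sum_triangle_flip _ (tr' _ _ _)).
all: rewrite ?misses_cat ?misses_toggle ?misses_cat ?misses_rev ?xX ?xY ?xA ?xB
  ?xC ?yX ?yY ?yA ?yB ?yC ?zX ?zY ?zA ?zB ?zC //.
all: by rewrite /odd_in misses_count.
Qed.

(** Smoothing at a crossing whose passages separate the first strand from the two
    others; the first strand is reversed. *)
Lemma abs_smooth_triangle_across c x y z P Q R P' Q' R' X Y Z :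
  triangle_flip x y z P Q R P' Q' R' ->
  gauss (Z ++ P ++ X ++ Q ++ Y ++ R) -> gauss (Z ++ P' ++ X ++ Q' ++ Y ++ R') ->
  has (on c) Z -> has (on c) X ->
  abs_smooth c (Z ++ P ++ X ++ Q ++ Y ++ R) =
  abs_smooth c (Z ++ P' ++ X ++ Q' ++ Y ++ R').
Proof.
move=> tr gT gT' cZ cX.
have gT1 := gT; rewrite gauss_catC -!catA in gT1.
have [mx my mz] := triangle_misses_all tr gT1.
have [Z1 [p [Z2 [ZE lp _]]]] := has_split cZ.
have [X1 [q [X2 [XE lq _]]]] := has_split cX.
rewrite -{}lp in cZ cX lq *; rewrite {}ZE {}XE in gT gT' mx my mz {gT1 cZ cX} *.
rewrite -!catA /= in gT gT' *.
have := @abs_smoothE g Z1 p (Z2 ++ P ++ X1) q (X2 ++ Q ++ Y ++ R).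
rewrite -!catA /= => -> //.
have := @abs_smoothE g Z1 p (Z2 ++ P' ++ X1) q (X2 ++ Q' ++ Y ++ R').
rewrite -!catA /= => -> //.
move: mx my mz; rewrite !(misses_cat, misses_cons).
move=> /and5P[/and3P[xX1 _ xX2] xY xZ1 _ xZ2] /and5P[/and3P[yX1 _ yX2] yY yZ1 _
  yZ2].
move=> /and5P[/and3P[zX1 _ zX2] zY zZ1 _ zZ2].
congr (`|_|); rewrite /smooth_sum /reverse_along.
have pm : perm_eq (Z2 ++ P' ++ X1) (Z2 ++ P ++ X1).
  have [PP' _ _] := triangle_perm tr.
  by rewrite perm_cat2l perm_cat2r perm_sym.
rewrite [in RHS](eq_map (eq_in_toggle pm)).
have [xP _ _] := triangle_count tr.
have [_ _ yP] := triangle_count (triangle_rot tr).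
have [_ zP _] := triangle_count (triangle_rot (triangle_rot tr)).
have tr' := triangle_reverse (T := odd_in (Z2 ++ P ++ X1)) tr.
rewrite !rev_cat -!catA !(map_cat _ (rev X1)) !(map_cat _ (rev P))
  !(map_cat _ (rev P')).
rewrite [rev Z2 ++ _]catA [rev Z2 ++ X2 ++ Q' ++ _]catA !(map_cat _ (rev Z2 ++ X2)).
rewrite !(map_cat _ Q) !(map_cat _ Q') !(map_cat _ Y) !(map_cat _ R)
  !(map_cat _ R').
apply: (chord_sum_triangle_flip _ (tr' _ _ _)).
1-3: by rewrite /odd_in !count_cat ?xP ?yP ?zP !misses_count.
all: rewrite !misses_cat !misses_toggle !misses_cat !misses_rev.
- by rewrite xX1 xZ2 xX2 xY xZ1.
- by rewrite yX1 yZ2 yX2 yY yZ1.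
- by rewrite zX1 zZ2 zX2 zY zZ1.
Qed.

(** A strand crosses two arcs at [y] and [z], or in the other order. The words are
    read from different base points, hence the hypothesis that the total shift is 0. *)
Lemma chord_sum_switch (d : bool) X Y Z y y' z z' v v' w w' :
  lab y' = lab y -> lab v = lab y -> lab v' = lab y ->
  lab z' = lab z -> lab w = lab z -> lab w' = lab z -> lab y != lab z ->
  misses (lab y) (X ++ Y ++ Z) -> misses (lab z) (X ++ Y ++ Z) ->
  shift_sum (X ++ Y ++ Z) = 0 ->
  shift y' = - shift y -> shift z = shift y -> shift z' = - shift y ->
  shift v = - shift y -> shift v' = shift y -> shift w = shift y ->
  shift w' = - shift y ->
  chord_sum flat (X ++ y :: Y ++ (if d then [:: y'; z] else [:: z; y']) ++ Z ++
    [:: z'])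
  = chord_sum flat (v :: X ++ w :: Y ++ (if d then [:: w'; v'] else [:: v'; w'])
    ++ Z).
Proof.
move=> ly' lv lv' lz' lw lw' nyz; rewrite !misses_cat.
move=> /and3P[yX yY yZ] /and3P[zX zY zZ]; rewrite !shift_sum_cat => s0.
move=> sy' sz sz' sv sv' sw sw'.
have nzy : (lab z == lab y) = false by rewrite eq_sym; apply: negPf.
have sX : shift_sum X = - (shift_sum Y + shift_sum Z).
  by rewrite -(addr0_eq s0) opprK.
have mY q : lab q = lab y -> [/\ misses (lab q) X, misses (lab q) Y &
  misses (lab q) Z].
  by move=> ->.
have mZ q : lab q = lab z -> [/\ misses (lab q) X, misses (lab q) Y &
  misses (lab q) Z].
  by move=> ->.
have [? ? ?] := mY _ ly'; have [? ? ?] := mY _ lv; have [? ? ?] := mY _ lv'.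
have [? ? ?] := mZ _ lz'; have [? ? ?] := mZ _ lw; have [? ? ?] := mZ _ lw'.
rewrite !chord_sumE; case: d.
all: rewrite !chord_sumE !hits_back_misses //.
all: rewrite !hits_misses //.
all: rewrite ?ly' ?lz' ?lw ?lw' ?lv ?lv' ?eqxx ?(negPf nyz) ?nzy.
all: rewrite ?flatE ?sy' ?sz ?sz' ?sv ?sv' ?sw ?sw' ?sX.
- have -> : 0 - (shift_sum Y + shift_sum Z) + shift y + shift_sum Y - shift y
          = - shift_sum Z by ring.
  by rewrite g_odd !(add0r, addr0); ring.
- have -> : 0 - (shift_sum Y + shift_sum Z) + shift y + shift_sum Y
          = - (- shift y + shift_sum Z) by ring.
  by rewrite g_odd !(add0r, addr0); ring.
Qed.

(** A bigon that contains the base point. *)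
Lemma chord_sum_bigon_ends (d : bool) X Y Z y y' z z' :
  lab y' = lab y -> lab z' = lab z -> lab y != lab z ->
  misses (lab y) (X ++ Y ++ Z) -> misses (lab z) (X ++ Y ++ Z) ->
  shift_sum (X ++ Y ++ Z) = 0 ->
  shift y' = - shift y -> shift z = shift y -> shift z' = - shift y ->
  chord_sum flat (y :: X ++ Y ++ (if d then [:: y'; z] else [:: z; y']) ++ Z ++
    [:: z'])
  = chord_sum flat (X ++ Y ++ Z).
Proof.
move=> ly' lz' nyz; rewrite !misses_cat.
move=> /and3P[yX yY yZ] /and3P[zX zY zZ]; rewrite !shift_sum_cat => s0.
move=> sy' sz sz'.
have nzy : (lab z == lab y) = false by rewrite eq_sym; apply: negPf.
have sX : shift_sum X = - (shift_sum Y + shift_sum Z).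
  by rewrite -(addr0_eq s0) opprK.
have mY q : lab q = lab y -> [/\ misses (lab q) X, misses (lab q) Y &
  misses (lab q) Z].
  by move=> ->.
have mZ q : lab q = lab z -> [/\ misses (lab q) X, misses (lab q) Y &
  misses (lab q) Z].
  by move=> ->.
have [? ? ?] := mY _ ly'; have [? ? ?] := mZ _ lz'.
rewrite !chord_sumE; case: d.
all: rewrite !chord_sumE !hits_back_misses // !hits_misses //.
all: rewrite ?ly' ?lz' ?eqxx ?(negPf nyz) ?nzy.
all: rewrite ?flatE ?sy' ?sz ?sz' ?sX.
- have -> : 0 - (shift_sum Y + shift_sum Z) + shift_sum Y = - shift_sum Z by ring.
  by rewrite g_odd !(add0r, addr0, addNr, subrr); ring.
- have -> : 0 - (shift_sum Y + shift_sum Z) + shift_sum Y + shift y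
          = - (- shift y + shift_sum Z) by ring.
  by rewrite g_odd !(add0r, addr0, addNr, subrr); ring.
Qed.

(** Smoothing at the vertex [x], when strand 1 follows the cyclic order of the
    vertices. The other case is obtained by exchanging the two words. *)
Lemma abs_smooth_triangle_half x y z (k e2 e3 : bool) z1 x1 x2 y2 y3 z3 X Y Z :
  let e1 := true in
  [/\ x != y, y != z & z != x] ->
  [/\ lab x1 = x, lab x2 = x, lab y2 = y & lab y3 = y] -> lab z3 = z /\ lab z1 =
    z ->
  lft x1 = (e1 (+) e2) (+) k /\ lft x2 = ~~ (e1 (+) e2) (+) k ->
  lft y2 = (e2 (+) e3) (+) k /\ lft y3 = ~~ (e2 (+) e3) (+) k ->
  lft z3 = (e3 (+) e1) (+) k /\ lft z1 = ~~ (e3 (+) e1) (+) k ->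
  let T := directed e1 [:: z1; x1] ++ X ++ directed e2 [:: x2; y2] ++ Y ++
    directed e3 [:: y3; z3] ++ Z in
  let T' := directed (~~ e1) [:: z1; x1] ++ X ++ directed (~~ e2) [:: x2; y2] ++
    Y ++ directed (~~ e3) [:: y3; z3] ++ Z in
  gauss T -> gauss T' -> gauss (X ++ Y ++ Z) ->
  [/\ misses x (X ++ Y ++ Z), misses y (X ++ Y ++ Z) & misses z (X ++ Y ++ Z)] ->
  abs_smooth x T = abs_smooth x T'.
Proof.
  move=> e1 [xy yz zx] [lx1 lx2 ly2 ly3] [lz3 lz1] [_ _] [sy2 sy3] [sz3 sz1].
  have [yx zy xz] : [/\ (y == x) = false, (z == y) = false & (x == z) = false].
    by split; apply/negbTE; rewrite // eq_sym.
  move/negbTE in xy; move/negbTE in yz; move/negbTE in zx.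
  move=> T T' gT gT' gXYZ [mx my mz].
  have pXYZ : perm_eq (rev X ++ Y ++ Z) (X ++ Y ++ Z).
    by rewrite perm_cat2r perm_rev.
  have gXYZ' t : gauss (map (toggle t) (rev X ++ Y ++ Z)).
    by apply: gauss_toggle; rewrite (gauss_perm pXYZ).
  have [yX [yY yZ]] : misses y X /\ misses y Y /\ misses y Z.
    by move: my; rewrite !misses_cat => /and3P[].
  have [zX [zY zZ]] : misses z X /\ misses z Y /\ misses z Z.
    by move: mz; rewrite !misses_cat => /and3P[].
  have Xy : odd_in X y = false by rewrite /odd_in misses_count.
  have Xz : odd_in X z = false by rewrite /odd_in misses_count.
  set t := toggle (odd_in X).
  have yt W : misses y W -> misses y (map t W) by rewrite misses_toggle.
  have zt W : misses z W -> misses z (map t W) by rewrite misses_toggle.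
  have sXYZ : shift_sum (map t (rev X) ++ map t Y ++ map t Z) = 0.
    by have := gauss_shift_sum (gXYZ' (odd_in X)); rewrite !map_cat.
  have yXYZ : misses y (map t (rev X) ++ map t Y ++ map t Z).
    by rewrite !misses_cat !yt // misses_rev.
  have zXYZ : misses z (map t (rev X) ++ map t Y ++ map t Z).
    by rewrite !misses_cat !zt // misses_rev.
  case: e2 sy2 sy3 @T @T' gT gT' => sy2 sy3 T T' gT gT'.
  + (* The third side crosses both arcs of the smoothing, in either order. *)
    have -> : abs_smooth x T = `|chord_sum flat (map (toggle (odd_in X))
       (rev X ++ y2 :: Y ++ directed e3 [:: y3; z3] ++ Z ++ [:: z1]))|.
      have := @abs_smoothE g [:: z1] x1 X x2 (y2 :: Y ++
        directed e3 [:: y3; z3] ++ Z).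
      by rewrite lx1 lx2 /= => -> //; rewrite /smooth_sum /reverse_along /= -!catA.
    have -> : abs_smooth x T' = `|chord_sum flat
      (map (toggle (odd_in (z1 :: X ++ [:: y2])))
       (y2 :: rev X ++ z1 :: Y ++ directed (~~ e3) [:: y3; z3] ++ Z))|.
      have := @abs_smoothE g [::] x1 (z1 :: X ++ [:: y2]) x2
        (Y ++ directed (~~ e3) [:: y3; z3] ++ Z).
      rewrite lx1 lx2 /T' /= -!catA /= => -> //.
      rewrite /smooth_sum /reverse_along /=  cats0 !rev_cons rev_cat -!cats1
        -!catA /=.
      by [].
    rewrite -/t; set t' := toggle (odd_in (z1 :: _)).
    have t'E W : misses y W -> misses z W -> map t' W = map t W.
      move=> yW zW; apply: map_toggle_eq => p pW; rewrite -[z1 :: _]cat1s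
        !count_cat /=.
      by rewrite (on_misses yW pW ly2) (on_misses zW pW lz1) !addn0.
    have [t'y t'z] : odd_in (z1 :: X ++ [:: y2]) y /\ odd_in (z1 :: X ++ [:: y2]) z.
      rewrite /odd_in -[z1 :: _]cat1s !count_cat !(@misses_count _ X) //=
        /on ly2 lz1.
      by rewrite zy yz !eqxx.
    have [sy3' sz3' sz1'] : [/\ shift y3 = - shift y2, shift z3 = shift y2 &
        shift z1 = - shift y2].
      rewrite /shift sy2 sy3 sz3 sz1; by case: (e3); case: (k).
    have -> : map t (rev X ++ y2 :: Y ++ directed e3 [:: y3; z3] ++ Z ++ [:: z1]) =
        map t (rev X) ++ t y2 :: map t Y ++
        (if e3 then [:: t y3; t z3] else [:: t z3; t y3]) ++ map t Z ++ [:: t z1].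
      by rewrite map_cat /= !map_cat; case: (e3).
    have -> : map t' (y2 :: rev X ++ z1 :: Y ++ directed (~~ e3) [:: y3; z3] ++ Z) =
        t' y2 :: map t (rev X) ++ t' z1 :: map t Y ++
        (if e3 then [:: t' z3; t' y3] else [:: t' y3; t' z3]) ++ map t Z.
      rewrite -!t'E ?misses_rev // map_cons map_cat map_cons !map_cat.
      by case: (e3).
    congr (`|_|); apply: chord_sum_switch; rewrite ?/t ?/t'.
    all: rewrite ?lab_toggle ?ly2 ?ly3 ?lz1 ?lz3 ?yz //.
    all: rewrite ?shift_toggle ?ly2 ?ly3 ?lz1 ?lz3 ?Xy ?Xz ?t'y ?t'z.
    all: rewrite ?sy3' ?sz3' ?sz1' ?opprK //.
  + (* The third side makes a bigon with one of the two arcs; removing it gives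
       the same word on both sides. *)
    have -> : abs_smooth x T = `|chord_sum flat
      (map (toggle (odd_in (X ++ [:: y2])))
       (y2 :: rev X ++ Y ++ directed e3 [:: y3; z3] ++ Z ++ [:: z1]))|.
      have := @abs_smoothE g [:: z1] x1 (X ++ [:: y2]) x2
        (Y ++ directed e3 [:: y3; z3] ++ Z).
      rewrite lx1 lx2 /T /= -!catA /= => -> //.
      by rewrite /smooth_sum /reverse_along rev_cat -!catA.
    have -> : abs_smooth x T' = `|chord_sum flat (map (toggle (odd_in (z1 :: X)))
       (rev X ++ [:: z1; y2] ++ Y ++ directed (~~ e3) [:: y3; z3] ++ Z))|.
      have := @abs_smoothE g [::] x1 (z1 :: X) x2 (y2 :: Y ++
        directed (~~ e3) [:: y3; z3] ++ Z).
      rewrite lx1 lx2 /T' /= => -> //.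
      by rewrite /smooth_sum /reverse_along cats0 rev_cons -cats1 -!catA.
    set t1 := toggle (odd_in (X ++ _)); set t2 := toggle (odd_in (z1 :: X)).
    have t1E W : misses y W -> misses z W -> map t1 W = map t W.
      move=> yW zW; apply: map_toggle_eq => p pW; rewrite count_cat /=.
      by rewrite (on_misses yW pW ly2) !addn0.
    have t2E W : misses y W -> misses z W -> map t2 W = map t W.
      move=> yW zW; apply: map_toggle_eq => p pW; rewrite /=.
      by rewrite (on_misses zW pW lz1).
    have [t1y t1z] : odd_in (X ++ [:: y2]) y /\ odd_in (X ++ [:: y2]) z = false.
      rewrite /odd_in !count_cat /= !(@misses_count _ X) // /on ly2.
      by rewrite yz !eqxx.
    have [t2y t2z] : odd_in (z1 :: X) y = false /\ odd_in (z1 :: X) z.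
      by rewrite /odd_in /= !(@misses_count _ X) // /on lz1 zy eqxx.
    have [sy3' sz3' sz1'] : [/\ shift y3 = - shift y2, shift z3 = - shift y2 &
        shift z1 = shift y2].
      rewrite /shift sy2 sy3 sz3 sz1; by case: (e3); case: (k).
    have -> : map t1 (y2 :: rev X ++ Y ++ directed e3 [:: y3; z3] ++ Z ++ [:: z1]) =
        t1 y2 :: map t (rev X) ++ map t Y ++
        (if e3 then [:: t1 y3; t1 z3] else [:: t1 z3; t1 y3]) ++ map t Z ++
          [:: t1 z1].
      rewrite -!t1E ?misses_rev // map_cons !map_cat.
      by case: (e3).
    have -> : map t2 (rev X ++ [:: z1; y2] ++ Y ++ directed (~~ e3) [:: y3; z3]
      ++ Z) =
        map t (rev X) ++ [:: t2 z1; t2 y2] ++ map t Y ++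
        (if e3 then [:: t2 z3; t2 y3] else [:: t2 y3; t2 z3]) ++ map t Z.
      rewrite -!t2E ?misses_rev // !map_cat.
      by case: (e3).
    rewrite chord_sum_bigon_ends ?chord_sum_bigon // ?/t1 ?/t2.
    all: rewrite ?lab_toggle ?ly2 ?ly3 ?lz1 ?lz3 ?yz ?zy //.
    all: rewrite ?flatE ?shift_toggle ?ly2 ?ly3 ?lz1 ?lz3 ?t1y ?t1z ?t2y ?t2z.
    all: rewrite ?sy3' ?sz3' ?sz1' ?opprK //;
      by move=> S; apply: flat_bigon; rewrite !shift_toggle lz1 ly2 t2y t2z sz1'
        opprK.
Qed.

Lemma abs_smooth_triangle_vertex x y z P Q R P' Q' R' X Y Z :
  triangle_flip x y z P Q R P' Q' R' ->
  gauss (P ++ X ++ Q ++ Y ++ R ++ Z) -> gauss (P' ++ X ++ Q' ++ Y ++ R' ++ Z) ->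
  abs_smooth x (P ++ X ++ Q ++ Y ++ R ++ Z) =
  abs_smooth x (P' ++ X ++ Q' ++ Y ++ R' ++ Z).
Proof.
move=> tr gT gT'; have mxyz := triangle_misses_all tr gT.
have gXYZ := triangle_gauss tr gT.
case: tr gT gT' => k [] e2 e3 z1 x1 x2 y2 y3 z3 nxyz lxy lz sx sy sz gT gT'.
  exact: (@abs_smooth_triangle_half x y z k e2 e3 z1 x1 x2 y2 y3 z3).
symmetry; case: e2 e3 sx sy sz gT gT' => [] [] sx sy sz gT gT'.
- exact: (@abs_smooth_triangle_half x y z k false false z1 x1 x2 y2 y3 z3).
- exact: (@abs_smooth_triangle_half x y z k false true z1 x1 x2 y2 y3 z3).
- exact: (@abs_smooth_triangle_half x y z k true false z1 x1 x2 y2 y3 z3).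
- exact: (@abs_smooth_triangle_half x y z k true true z1 x1 x2 y2 y3 z3).
Qed.

(** Both words may be read from another base point. *)
Lemma abs_smooth_turn c P X W P' W' :
  gauss (P ++ X ++ W) -> gauss (P' ++ X ++ W') ->
  has (on c) (P ++ X ++ W) -> has (on c) (P' ++ X ++ W') ->
  abs_smooth c (W ++ P ++ X) = abs_smooth c (W' ++ P' ++ X) ->
  abs_smooth c (P ++ X ++ W) = abs_smooth c (P' ++ X ++ W').
Proof.
move=> gT gT' hT hT' e; rewrite !catA in gT gT' hT hT' *.
by rewrite abs_smooth_rot // e -abs_smooth_rot.
Qed.

(** Smoothing at a crossing outside the triangle with a passage in the last arc. *)
Lemma abs_smooth_triangle_outside c x y z P Q R P' Q' R' X Y Z :
  triangle_flip x y z P Q R P' Q' R' ->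
  gauss (P ++ X ++ Q ++ Y ++ R ++ Z) -> gauss (P' ++ X ++ Q' ++ Y ++ R' ++ Z) ->
  misses c (P ++ Q ++ R) -> has (on c) Z -> has (on c) X || misses c Y ->
  abs_smooth c (P ++ X ++ Q ++ Y ++ R ++ Z) =
  abs_smooth c (P' ++ X ++ Q' ++ Y ++ R' ++ Z).
Proof.
move=> tr gT gT' mc cZ; case cX: (has (on c) X) => /= mY.
  have h5 U V W (S : seq endpoint) A : U ++ V ++ W ++ S ++ A ++ Z =
    (U ++ V ++ W ++ S ++ A) ++ Z.
    by rewrite -!catA.
  rewrite !h5 in gT gT' *; rewrite abs_smooth_rot ?has_cat ?cZ ?orbT //.
  rewrite [RHS]abs_smooth_rot ?has_cat ?cZ ?orbT //.
  by apply: (abs_smooth_triangle_across tr) => //; rewrite gauss_catC.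
have mX : misses c X by rewrite /misses cX.
apply: (abs_smooth_triangle_same tr) => //; move: mc.
by rewrite !misses_cat mX mY => /and3P[-> -> ->].
Qed.

Lemma abs_smooth_triangle c x y z P Q R P' Q' R' X Y Z :
  triangle_flip x y z P Q R P' Q' R' ->
  gauss (P ++ X ++ Q ++ Y ++ R ++ Z) -> gauss (P' ++ X ++ Q' ++ Y ++ R' ++ Z) ->
  has (on c) (P ++ X ++ Q ++ Y ++ R ++ Z) ->
  abs_smooth c (P ++ X ++ Q ++ Y ++ R ++ Z) =
  abs_smooth c (P' ++ X ++ Q' ++ Y ++ R' ++ Z).
Proof.
move=> tr gT gT' hc.
have pm : perm_eq (P' ++ X ++ Q' ++ Y ++ R' ++ Z) (P ++ X ++ Q ++ Y ++ R ++ Z).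
  by have [PP QQ RR] := triangle_perm tr; rewrite perm_sym;
    do 5![apply: perm_cat => //].
have hc' : has (on c) (P' ++ X ++ Q' ++ Y ++ R' ++ Z).
  by rewrite has_count (permP pm) -has_count.
have tr1 := triangle_rot tr; have tr2 := triangle_rot tr1.
have turn A B C : gauss (A ++ B ++ C) = gauss (C ++ A ++ B).
  by rewrite catA gauss_catC.
have hturn A B C : has (on c) (A ++ B ++ C) = has (on c) (C ++ A ++ B).
  by rewrite !has_cat orbA orbC.
have gT1 := gT; have gT1' := gT'; have hc1 := hc; have hc1' := hc'.
rewrite turn -!catA in gT1; rewrite turn -!catA in gT1'.
rewrite hturn -!catA in hc1; rewrite hturn -!catA in hc1'.
have gT2 := gT1; have gT2' := gT1'; have hc2 := hc1; have hc2' := hc1'.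
rewrite turn -!catA in gT2; rewrite turn -!catA in gT2'.
rewrite hturn -!catA in hc2; rewrite hturn -!catA in hc2'.
have [cx|ncx] := eqVneq c x; first by rewrite cx (abs_smooth_triangle_vertex tr).
have [cy|ncy] := eqVneq c y.
  apply: abs_smooth_turn => //; rewrite -!catA.
  by rewrite cy (abs_smooth_triangle_vertex tr1).
have [cz|ncz] := eqVneq c z.
  apply: abs_smooth_turn => //; rewrite -!catA.
  apply: abs_smooth_turn => //; rewrite -!catA.
  by rewrite cz (abs_smooth_triangle_vertex tr2).
have [PL QL RL] := triangle_labels tr.
have out s : all (fun p => lab p \in [:: x; y; z]) s -> misses c s.
  move=> sL; apply/hasPn => p ps; apply/eqP => lp.
  by have := allP sL p ps; rewrite lp !inE (negPf ncx) (negPf ncy) (negPf ncz).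
have [cP cQ cR] : [/\ misses c P, misses c Q & misses c R] by split; apply: out.
(* Turning the circle, one may assume that c ends in Z, and that its other end
   is in X or in Z. *)
case hZ: (has (on c) Z && (has (on c) X || misses c Y)).
  by case/andP: hZ => *; apply: (abs_smooth_triangle_outside tr) => //;
    rewrite !misses_cat cP cQ cR.
case hX: (has (on c) X && (has (on c) Y || misses c Z)).
  apply: abs_smooth_turn => //; rewrite -!catA.
  by case/andP: hX => *; apply: (abs_smooth_triangle_outside tr1) => //;
    rewrite !misses_cat cP cQ cR.
case hY: (has (on c) Y && (has (on c) Z || misses c X)).
  apply: abs_smooth_turn => //; rewrite -!catA.
  apply: abs_smooth_turn => //; rewrite -!catA.
  by case/andP: hY => *; apply: (abs_smooth_triangle_outside tr2) => //;
    rewrite !misses_cat cP cQ cR.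
move: hc; rewrite !has_cat (negPf cP) (negPf cQ) (negPf cR) /=.
by move: hX hY hZ; rewrite /misses; case: (has _ X); case: (has _ Y);
  case: (has _ Z).
Qed.

Lemma smooth_count_triangle k x y z P Q R P' Q' R' X Y Z :
  triangle_flip x y z P Q R P' Q' R' ->
  gauss (P ++ X ++ Q ++ Y ++ R ++ Z) -> gauss (P' ++ X ++ Q' ++ Y ++ R' ++ Z) ->
  smooth_count k (P ++ X ++ Q ++ Y ++ R ++ Z) =
  smooth_count k (P' ++ X ++ Q' ++ Y ++ R' ++ Z).
Proof.
move=> tr gT gT'; apply: smooth_count_perm => [|c hc].
  by have [PP QQ RR] := triangle_perm tr; do 5![apply: perm_cat => //].
exact: (abs_smooth_triangle tr).
Qed.

End Flat.

(** * The Gauss word of a diagram *)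

(** Passages have decidable equality, by an encoding as triples. *)
Definition passage_code (p : passage) : nat * bool * option bool :=
  (label p, from_left p,
   match height p with Over => Some true | Under => Some false | Virtual =>
     None end).
Definition passage_decode (c : nat * bool * option bool) : passage :=
  Passage c.1.1 c.1.2
    match c.2 with Some true => Over | Some false => Under | None => Virtual end.
Lemma passage_codeK : cancel passage_code passage_decode.
Proof. by case=> x s []. Qed.
HB.instance Definition _ := Equality.copy passage (can_type passage_codeK).

Definition endpoint_of (p : passage) : endpoint :=
  (label p, from_left p, is_over (height p)).

(** The Gauss word of a code: virtual crossings are forgotten. *)
Definition gword (w : code) : seq endpoint :=
  [seq endpoint_of p | p <- w & is_classical (height p)].

Lemma gword_cat u v : gword (u ++ v) = gword u ++ gword v.
Proof. by rewrite /gword filter_cat map_cat. Qed.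

Lemma gword_rev w : gword (rev w) = rev (gword w).
Proof. by rewrite /gword filter_rev map_rev. Qed.

Lemma gword_cons p w :
  gword (p :: w) = if is_classical (height p) then endpoint_of p ::
    gword w else gword w.
Proof. by rewrite /gword /=; case: ifP. Qed.

Lemma two_passagesP w x : two_passages w x ->
  exists p q, [/\ [seq p <- w | through x p] = [:: p; q],
    from_left q = ~~ from_left p & height q = opposite (height p)].
Proof.
rewrite /two_passages; case: [seq _ <- w | _] => [|p [|q [|]]] //.
case/andP=> /eqP sq hq; exists p, q; split=> //.
by move: hq; case: (height p); case: (height q).
Qed.

(** The two passages through a double point of a valid code, one of them being given. *)
Lemma valid_passages w p : valid_code w -> p \in w ->
  exists q, [/\ [seq r <- w | through (label p) r] = [:: p; q] \/
                [seq r <- w | through (label p) r] = [:: q; p],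
    from_left q = ~~ from_left p & height q = opposite (height p)].
Proof.
move=> /allP vw pw; have [a [b [ab sb hb]]] := two_passagesP
  (vw _ (map_f label pw)).
have: p \in [seq r <- w | through (label p) r] by rewrite mem_filter /through eqxx.
rewrite ab !inE => /orP[]/eqP pE; rewrite pE.
- by exists b; split=> //; left.
- by exists a; split; [right| rewrite sb negbK | rewrite hb; case: (height a)].
Qed.

Lemma valid_gauss w : valid_code w -> gauss (gword w).
Proof.
move=> vw; (* No passage is repeated, since its twin has the other side. *)
have uw : uniq w.
  apply: count_mem_uniq => p; case: (boolP (p \in w)) => [pw|/count_memPn //].
  have [q [fE sq _]] := valid_passages vw pw.
  have npq : (q == p) = false.
    by apply/eqP => e; move: sq; rewrite e; case: (from_left p).
  have -> : count_mem p w = count_mem p [seq r <- w | through (label p) r].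
    rewrite count_filter; apply: eq_count => r /=.
    by case: eqP => [->|//]; rewrite /through eqxx.
  by case: fE => -> /=; rewrite npq eqxx.
apply/andP; split.
  rewrite /gword -map_comp map_inj_in_uniq ?filter_uniq // => p r.
  rewrite !mem_filter => /andP[_ pw] /andP[_ rw] [e1 e2].
  have [q [fE sq _]] := valid_passages vw pw.
  have : r \in [seq r <- w | through (label p) r] by rewrite mem_filter /through
    e1 eqxx.
  case: fE => ->; rewrite !inE => /orP[]/eqP // rE;
    by move: sq; rewrite -rE -e2; case: (from_left p).
apply/allP => r /mapP[p]; rewrite mem_filter => /andP[cp pw] {r}->.
have [q [fE sq hq]] := valid_passages vw pw.
have : q \in [seq r <- w | through (label p) r].
  by case: fE => ->; rewrite !inE eqxx ?orbT.
rewrite mem_filter => /andP[/eqP lq qw]; apply/mapP; exists q.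
  by rewrite mem_filter qw andbT hq; move: cp; case: (height p).
rewrite /mate /endpoint_of /lab /lft /ovr /= lq sq hq.
by move: cp; case: (height p).
Qed.

Lemma shift_sum_gword w : shift_sum (gword w) = \sum_(p <- w) label_shift p.
Proof.
elim: w => [|p w IH]; first by rewrite big_nil shift_sum_nil.
rewrite gword_cons big_cons -IH /label_shift.
by case: (height p) => /=; rewrite ?shift_sum_cons ?add0r.
Qed.

Lemma gauss_lab_neq A a B b C : gauss (A ++ a :: B ++ b :: C) ->
  lft a = lft b -> lab a != lab b.
Proof.
move=> gw ab; apply/eqP => lab_ab; have := gauss_mate gw (esym lab_ab).
by move/(congr1 lft); rewrite lft_mate -ab; case: (lft a).
Qed.

(** Numbering the strands in the opposite cyclic order. *)
Lemma triangle_mirror x y z P Q R P' Q' R' :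
  triangle_flip x y z P Q R P' Q' R' -> triangle_flip z y x P R Q P' R' Q'.
Proof.
have dirN e (a b : endpoint) : directed e [:: a; b] = directed (~~ e) [:: b; a].
  by case: e.
case=> k e1 e2 e3 z1 x1 x2 y2 y3 z3 [xy yz zx] [lx1 lx2 ly2 ly3] [lz3 lz1].
move=> [sx1 sx2] [sy2 sy3] [sz3 sz1]; rewrite !(dirN _ _ x1) !(dirN _ _ y2)
  !(dirN _ _ z3).
apply: (TriangleFlip (k := ~~ k)) => //;
  rewrite ?sx1 ?sx2 ?sy2 ?sy3 ?sz3 ?sz1 1?eq_sym; try split=> //.
all: rewrite 1?eq_sym //.
all: by case: (e1); case: (e2); case: (e3); case: (k).
Qed.

Lemma gword_along e p q : is_classical (height p) -> is_classical (height q) ->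
  gword (along e [:: p; q]) = directed e [:: endpoint_of p; endpoint_of q].
Proof.
move=> cp cq; have pq : gword [:: p; q] = [:: endpoint_of p; endpoint_of q].
  by rewrite !gword_cons cp cq.
by case: e; rewrite /along ?gword_rev pq.
Qed.

(** A triangle with three classical vertices. Distinctness of the vertices comes from
    the labels being met twice only. *)
Lemma gword_strands (t : triangle) (S1 S2 S3 W : seq endpoint) :
  nb_virtual t = 0%N ->
  perm_eq S1 (gword (strand1 t)) -> perm_eq S2 (gword (strand2 t)) ->
  perm_eq S3 (gword (strand3 t)) -> gauss (S1 ++ S2 ++ S3 ++ W) ->
  triangle_flip (vx t) (vy t) (vz t)
    (gword (strand1 t)) (gword (strand2 t)) (gword (strand3 t))
    (gword (strand1 (flip_triangle t))) (gword (strand2 (flip_triangle t)))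
    (gword (strand3 (flip_triangle t))).
Proof.
case: t => e1 e2 e3 x y z lx ly lz; rewrite /nb_virtual /= => nv p1 p2 p3 gT.
have [cx cy cz] : [/\ is_classical lx, is_classical ly & is_classical lz].
  by case: (lx) (ly) (lz) nv => [] [] [].
have [cx' cy' cz'] : [/\ is_classical (opposite lx), is_classical (opposite ly)
   & is_classical (opposite lz)].
  by split; [case: (lx) cx | case: (ly) cy | case: (lz) cz].
rewrite /strand1 /strand2 /strand3 !gword_along //= in p1 p2 p3 *.
have nE a b : (~~ a != ~~ b) = (a != b) by case: a; case: b.
have eE a b : (~~ a == ~~ b) = (a == b) by case: a; case: b.
rewrite !nE !eE.
have cnt l : (count (on l) S1 + (count (on l) S2 + count (on l) S3) <= 2)%N.
  have := gauss_count l gT; rewrite !count_cat; apply: leq_trans.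
  by rewrite leq_add2l leq_add2l leq_addr.
have nxyz : [/\ x != y, y != z & z != x].
  split; apply/eqP => e; [have := cnt x|have := cnt y|have := cnt z];
  rewrite (permP p1) (permP p2) (permP p3) !count_directed /on /endpoint_of /lab
    /= ?e !eqxx;
  by case: eqP.
apply: (TriangleFlip (k := true)) => //.
all: by rewrite /lft /=; case: (e1); case: (e2); case: (e3).
Qed.

(** With two virtual vertices, each strand has at most one classical passage, and the
    move does not change the Gauss word. *)
Lemma gword_strand_flip (t : triangle) : (1 < nb_virtual t)%N ->
  [/\ gword (strand1 (flip_triangle t)) = gword (strand1 t),
      gword (strand2 (flip_triangle t)) = gword (strand2 t) &
      gword (strand3 (flip_triangle t)) = gword (strand3 t)].
Proof.
case: t => e1 e2 e3 x y z lx ly lz; rewrite /nb_virtual /= => nv.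
split; [move: nv; case: (e3); case: (e1); case: (e2); case: (lx); case: (ly);
  case: (lz) |
  move: nv; case: (e2); case: (e1); case: (e3); case: (lx); case: (ly); case: (lz) |
  move: nv; case: (e3); case: (e2); case: (e1); case: (lx); case: (ly);
    case: (lz) ] => //.
Qed.

Lemma perm_move3 (T : eqType) (A S1 B S2 C S3 W : seq T) :
  perm_eq (A ++ S1 ++ B ++ S2 ++ C ++ S3 ++ W) (S1 ++ S2 ++ S3 ++ A ++ B ++ C ++ W).
Proof.
apply/permP => a; rewrite !count_cat; lia.
Qed.

(** * Invariance under equivalence of diagrams *)

Section Invariant.
Variables (Val : Type) (I : seq endpoint -> Val).
Hypothesis I_rename : forall f w, injective f -> gauss w ->
  I (map (fun p => (f (lab p), lft p, ovr p)) w) = I w.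
Hypothesis I_rot : forall u v, gauss (u ++ v) -> I (u ++ v) = I (v ++ u).
Hypothesis I_kink : forall a w, gauss ([:: a; mate a] ++ w) -> gauss w ->
  I ([:: a; mate a] ++ w) = I w.
Hypothesis I_bigon : forall x y P Q X Y l, bigon x y P Q ->
  gauss (P ++ X ++ Q ++ Y) -> gauss (X ++ Y) ->
  {in P, forall p, ovr p = l} -> {in Q, forall q, ovr q = ~~ l} ->
  I (P ++ X ++ Q ++ Y) = I (X ++ Y).
Hypothesis I_triangle : forall x y z P Q R P' Q' R' X Y Z,
  triangle_flip x y z P Q R P' Q' R' ->
  gauss (P ++ X ++ Q ++ Y ++ R ++ Z) -> gauss (P' ++ X ++ Q' ++ Y ++ R' ++ Z) ->
  I (P ++ X ++ Q ++ Y ++ R ++ Z) = I (P' ++ X ++ Q' ++ Y ++ R' ++ Z).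

Lemma invariant_isotopy D D' :
  gauss (gword (word D)) -> isotopy D D' ->
  I (gword (word D)) = I (gword (word D')).
Proof.
move=> gD iso; case: iso => [f injf|k b con] /=; last first.
  by rewrite /rot gword_cat -{1}(cat_take_drop k (word D)) gword_cat I_rot //
    -gword_cat cat_take_drop.
rewrite -(I_rename injf) // /gword filter_map -!map_comp.
by congr I.
Qed.

Lemma invariant_move1 P w w' : gauss (gword w) -> gauss (gword w') ->
  move1 P w w' -> I (gword w) = I (gword w').
Proof.
move=> + + m; case: m => A B x s l _; rewrite !gword_cat => gD gD'.
have [cl|/negPn vl] := boolP (is_classical l); last first.
  suff -> : gword (kink x s l) = [::] by [].
  by case: (l) vl.
have kE : gword (kink x s l) = [:: (x, s, is_over l); mate (x, s, is_over l)].
  by case: (l) cl.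
rewrite kE in gD' *; have gD1 := gD'; rewrite gauss_catC -catA in gD1.
rewrite I_rot // (I_rot gD') -catA; symmetry; apply: I_kink => //.
by rewrite gauss_catC.
Qed.

Lemma invariant_move2 P w w' : gauss (gword w) -> gauss (gword w') ->
  move2 P w w' -> I (gword w) = I (gword w').
Proof.
move=> + + m; case: m => A B C x y s l d _; rewrite !gword_cat => gD gD'.
have [cl|/negPn vl] := boolP (is_classical l); last first.
  have -> : gword (bigon1 x y s l) = [::] by case: (l) vl.
  suff -> : gword (bigon2 x y s l d) = [::] by [].
  by case: (l) vl; case: (d).
have P1 : gword (bigon1 x y s l) = [:: (x, s, is_over l); (y, ~~ s, is_over l)].
  by case: (l) cl.
have P2 : gword (bigon2 x y s l d) =
    if d then [:: (x, ~~ s, ~~ is_over l); (y, s, ~~ is_over l)]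
    else [:: (y, s, ~~ is_over l); (x, ~~ s, ~~ is_over l)].
  by case: (l) cl; case: (d).
rewrite P1 P2 in gD' *.
have nxy : x != y.
  case: d gD' {P2} => gD'.
  - have := @gauss_lab_neq (gword A) (x, s, is_over l) ((y, ~~ s, is_over l) ::
    gword B ++ [:: (x, ~~ s, ~~ is_over l)]) (y, s, ~~ is_over l) (gword C).
    by rewrite /= -catA /=; apply.
  - have := @gauss_lab_neq (gword A) (x, s, is_over l) ((y, ~~ s, is_over l) ::
    gword B) (y, s, ~~ is_over l) ((x, ~~ s, ~~ is_over l) :: gword C).
    by rewrite /= ; apply.
have gD1 := gD; rewrite gauss_catC -catA in gD1.
have gD1' := gD'; rewrite gauss_catC -!catA in gD1'.
rewrite I_rot // (I_rot gD') -!catA; symmetry; apply: (I_bigon (l := is_over l))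
  gD1' gD1 _ _.
- apply: Bigon nxy _ _ _ _ _ _ _ => //; by rewrite /shift /lft /=; case: (s).
- by move=> p; rewrite !inE => /orP[]/eqP->.
- by move=> p; case: (d); rewrite !inE => /orP[]/eqP->.
Qed.

Lemma invariant_move3 (P : pred triangle) w w' :
  (forall t, P t -> nb_virtual t != 1%N) ->
  gauss (gword w) -> gauss (gword w') ->
  move3 P w w' -> I (gword w) = I (gword w').
Proof.
move=> P1 + + m; case: m => A B C W t /P1 nv; rewrite !gword_cat => gD gD'.
all: have [nv2|nv0] := ltnP 1 (nb_virtual t);
  first by have [-> -> ->] := gword_strand_flip nv2.
all: have {nv nv0} nv0 : nb_virtual t = 0%N by case: (nb_virtual t) nv nv0 => [|[]].
all: have gD1 := gD; rewrite gauss_catC -!catA in gD1.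
all: have gD1' := gD'; rewrite gauss_catC -!catA in gD1'.
all: rewrite I_rot // (I_rot gD') -!catA.
- apply: (I_triangle (x := vx t) (y := vy t) (z := vz t)) => //.
  move: gD; rewrite (gauss_perm (perm_move3 _ _ _ _ _ _ _)).
  exact: gword_strands.
- apply: (I_triangle (x := vz t) (y := vy t) (z := vx t)) => //.
  apply: triangle_mirror.
  move: gD; rewrite (gauss_perm (perm_move3 _ _ _ _ _ _ _)).
  have pp S1 S2 S3 V : perm_eq (S1 ++ S3 ++ S2 ++ V : seq endpoint)
    (S1 ++ S2 ++ S3 ++ V).
    by rewrite perm_cat2l perm_catCA.
  rewrite (gauss_perm (pp _ _ _ _)).
  exact: gword_strands.
Qed.

(** A function of Gauss words is an invariant of diagrams once it is invariant under
    relabeling, change of base point, and the classical moves performed at the base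
    point. *)
Lemma invariant_equivalent D D' :
  equivalent D D' -> I (gword (word D)) = I (gword (word D')).
Proof.
elim=> {D D'} [D D'|//|D D' _ ->//|D1 D2 D3 _ -> _ ->//].
case=> /andP[/valid_gauss vD _] [/andP[/valid_gauss vD' _]] [|[_]].
  exact: invariant_isotopy.
case=> [|[|[|[|[|[]]]]]].
- exact: invariant_move1.
- exact: invariant_move2.
- by apply: invariant_move3 => // t /andP[/eqP->].
- exact: invariant_move1.
- exact: invariant_move2.
- by apply: invariant_move3 => // t /eqP->.
- by apply: invariant_move3 => // t /eqP->.
Qed.

End Invariant.

(** * Writhes as chord sums *)

Lemma hits0 (F : endpoint -> int -> int) p S w : (forall S, F p S = 0) ->
  hits F p S w = 0.
Proof. by move=> F0; elim: w S => //= q w IH S; rewrite IH F0 if_same addr0. Qed.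

Lemma chord_sum0l F u v : (forall p S, p \in u -> F p S = 0) ->
  chord_sum F (u ++ v) = chord_sum F v.
Proof.
elim: u => //= p u IH F0; rewrite IH => [|q S qu]; last by rewrite F0 //
  inE qu orbT.
by rewrite hits0 ?add0r // => S; rewrite F0 // mem_head.
Qed.

Lemma chord_sumB F F' w :
  chord_sum (fun p S => F p S - F' p S) w = chord_sum F w - chord_sum F' w.
Proof.
have hB p S v : hits (fun p S => F p S - F' p S) p S v =
  hits F p S v - hits F' p S v.
  elim: v S => [|q v IH] S /=; first by rewrite subr0.
  by rewrite IH; case: eqP => _; ring.
by elim: w => [|p w IH] /=; rewrite ?subr0 // IH hB; ring.
Qed.

Lemma chord_sum_big (J : Type) (X : seq J) (G : J -> endpoint -> int -> int) w :
  chord_sum (fun p S => \sum_(c <- X) G c p S) w = \sum_(c <- X) chord_sum (G c) w.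
Proof.
have hB p S v : hits (fun p S => \sum_(c <- X) G c p S) p S v =
    \sum_(c <- X) hits (G c) p S v.
  elim: v S => [|q v IH] S /=; first by rewrite big1.
  rewrite IH; case: eqP => _; first by rewrite -big_split.
  by rewrite add0r; apply: eq_bigr => c _; rewrite add0r.
elim: w => [|p w IH] /=; first by rewrite big1.
by rewrite IH hB -big_split.
Qed.

Lemma eq_chord_sum F F' w : (forall p S, p \in w -> F p S = F' p S) ->
  chord_sum F w = chord_sum F' w.
Proof. by move=> FF; rewrite -[w in RHS]map_id (chord_sum_map (F := F)) // =>
  p S /FF. Qed.

(** The term of a single crossing. *)
Lemma chord_sum_one F c A p B q C :
  gauss (A ++ p :: B ++ q :: C) -> lab p = c -> lab q = c ->
  chord_sum (fun r S => if lab r == c then F r S else 0) (A ++ p :: B ++ q :: C)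
    = F p (shift_sum B).
Proof.
move=> gw lp lq; have [] := gauss_misses gw; rewrite ?lq lp // => mA mB mC.
have out w r : misses c w -> r \in w -> (lab r == c) = false.
  by move=> mw rw; apply: contraNF mw => /eqP; apply: mem_on.
rewrite chord_sum0l => [|r S /(out _ _ mA)->] //=.
rewrite chord_sum0l => [|r S /(out _ _ mB)->] //=.
rewrite hits_cat /= !hits_misses ?lp ?lq // !eqxx !add0r !addr0.
by rewrite -[C]cats0 chord_sum0l ?addr0 // => r S /(out _ _ mC)->.
Qed.
Section Crossing.
Variables (D : diagram) (c : nat).
Hypotheses (vD : valid_code (word D)) (cD : c \in classical_crossings D).

(** The word cut at the two passages through [c], [p] being the first one. *)
Lemma crossing_split : exists A p B q C,
  [/\ word D = A ++ p :: B ++ q :: C, label p = c /\ label q = c,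
      from_left q = ~~ from_left p,
      is_classical (height p) /\ height q = opposite (height p) &
      [/\ ~~ has (through c) A, ~~ has (through c) B & ~~ has (through c) C]].
Proof.
have cw : c \in map label (word D).
  by case/mapP: cD => p; rewrite mem_filter => /andP[_ pw] ->; apply: map_f.
have := allP vD c cw => /two_passagesP[p [q [fE sq hq]]]; have fE0 := fE.
have hcw : has (through c) (word D) by rewrite has_filter fE.
case: (split_find hcw) fE => p' A w1 tp' nA; rewrite filter_cat filter_rcons tp'.
rewrite (eqP (_ : [seq x <- A | through c x] == [::]));
  last by rewrite -[_ == _]negbK -has_filter.
rewrite /= => -[pE fE]; rewrite {}pE in tp' *.
have hw1 : has (through c) w1 by rewrite has_filter fE.
case: (split_find hw1) fE => q' B C tq' nB; rewrite filter_cat filter_rcons tq'.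
rewrite (eqP (_ : [seq x <- B | through c x] == [::]));
  last by rewrite -[_ == _]negbK -has_filter.
rewrite /= => -[qE fC]; rewrite {}qE in tq' *.
exists A, p, B, q, C; split=> //; first by rewrite !cat_rcons.
- by split; apply/eqP.
- split=> //; case/mapP: cD => r; rewrite mem_filter => /andP[ro rw] rc.
  have : r \in [seq p <- word D | through c p] by rewrite mem_filter rw andbT
    /through rc.
  rewrite fE0 !inE => /orP[]/eqP rE; rewrite rE in ro.
  + by case: (height p) ro.
  + by move: ro; rewrite hq; case: (height p).
- by split=> //; rewrite has_filter fC.
Qed.

Section Split.
Variables (A B C : code) (p q : passage).
Hypotheses (wE : word D = A ++ p :: B ++ q :: C)
  (lp : label p = c) (lq : label q = c)
  (sq : from_left q = ~~ from_left p)
  (cp : is_classical (height p)) (hq : height q = opposite (height p))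
  (nA : ~~ has (through c) A) (nB : ~~ has (through c) B)
  (nC : ~~ has (through c) C).

Let sP := shift (endpoint_of p).
Let S := shift_sum (gword B).

Lemma sgn_split : sgn D c = if is_over (height p) then - sP else sP.
Proof.
rewrite /sgn wE.
have out (a : pred passage) w : ~~ has (through c) w ->
    has (fun r => through c r && a r) w = false.
  by move=> nw; apply: contraNF nw; apply: sub_has => r /= /andP[].
rewrite has_cat out //= has_cat out //= out // orbF /= /through lp lq eqxx /=.
rewrite sq hq /sP /shift /lft /endpoint_of /=.
by move: cp; case: (height p) => //; case: (from_left p).
Qed.

Lemma position_split s :
  position D c s = if from_left p == s then size A else (size A + (size B).+1)%N.
Proof.
have out (a : pred passage) w : ~~ has (through c) w ->
    has (fun r => through c r && a r) w = false.
  by move=> nw; apply: contraNF nw; apply: sub_has => r /= /andP[].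
rewrite /position wE find_cat out //= /through lp eqxx /=.
case: eqP => [_|ns]; first by rewrite addn0.
rewrite find_cat -/(through c) (out (fun r => from_left r == s)) //= lq eqxx sq /=.
rewrite (_ : _ == s); first by rewrite addn0.
by case: (from_left p) s ns => -[].
Qed.

(** The index is minus the total shift on the way from the overcrossing to the
    undercrossing. *)
Lemma Ind_split : Ind D c = if is_over (height p) then - S else S.
Proof.
rewrite /Ind /Ind_of !position_split sgn_split /arc_label.
have aA : \sum_(r <- take (size A) (word D)) label_shift r =
  \sum_(r <- A) label_shift r.
  by rewrite wE take_size_cat.
have aB : \sum_(r <- take (size A + (size B).+1) (word D)) label_shift r =
    \sum_(r <- A) label_shift r + sP + S.
  rewrite wE -cat_cons catA take_size_cat ?size_cat // big_cat big_cons /=.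
  rewrite /S shift_sum_gword addrA /sP /label_shift /shift /lft /=.
  by move: cp; case: (height p).
rewrite /sP /shift /lft /= in aB *; move: aB.
by case: (from_left p) => /=; rewrite aA => ->; case: (is_over _); ring.
Qed.

Lemma gword_split : gword (word D) =
  gword A ++ endpoint_of p :: gword B ++ endpoint_of q :: gword C.
Proof.
rewrite wE gword_cat gword_cons cp gword_cat gword_cons hq.
by have -> : is_classical (opposite (height p)) by move: cp; case: (height p).
Qed.

End Split.
End Crossing.

(** Weight for which the chord sum is the [n]-th writhe: a crossing whose first passage
    [p] is over has sign [- shift p] and index [- S], and one whose first passage is
    under has sign [shift p] and index [S]. *)
Definition index_weight (n : int) (p : endpoint) (S : int) : int :=
  if ovr p then (if S == - n then - shift p else 0)
  else (if S == n then shift p else 0).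

Lemma classical_crossingsE D :
  classical_crossings D = [seq lab p | p <- gword (word D) & ovr p].
Proof.
rewrite /classical_crossings /gword filter_map -map_comp -filter_predI.
by congr map; apply: eq_filter => p /=; case: (height p).
Qed.

Lemma classical_crossings_uniq D : valid_code (word D) ->
  uniq (classical_crossings D).
Proof.
move=> /valid_gauss gw; rewrite classical_crossingsE map_inj_in_uniq.
  by rewrite filter_uniq // gauss_uniq.
have /andP[_ /allP mw] := gw.
move=> p r; rewrite !mem_filter => /andP[po pw] /andP[ro rw] lpr.
apply: (gauss_fst_inj gw) => //.
have [e|ne] := eqVneq (lft p) (lft r).
  by case: p r lpr e {po pw ro rw} => [[x s] o] [[y t] o']; rewrite /lab /lft /=
    => -> ->.
have : mate p = r.
  apply: (gauss_fst_inj gw) => //; first exact: mw.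
  case: p r lpr ne {po pw ro rw} => [[x s] o] [[y t] o'];
    rewrite /lab /lft /mate /= => -> ne.
  by congr (_, _); move: ne; case: s; case: t.
by move=> /(congr1 ovr); rewrite ro /mate /ovr /=; move: po; rewrite /ovr => ->.
Qed.

Lemma lab_classical_crossings D p : valid_code (word D) ->
  p \in gword (word D) -> lab p \in classical_crossings D.
Proof.
move=> /valid_gauss gw pw; have /andP[_ /allP mw] := gw.
rewrite classical_crossingsE; apply/mapP.
have [po|npo] := boolP (ovr p); first by exists p; rewrite // mem_filter po.
by exists (mate p); rewrite // mem_filter mw // andbT.
Qed.

Lemma writhe_chord_sum n D : valid_code (word D) ->
  writhe n D = chord_sum (index_weight n) (gword (word D)).
Proof.
move=> vD; have gw := valid_gauss vD.
rewrite (@eq_chord_sum _ (fun p S => \sum_(c <- classical_crossings D)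
   if lab p == c then index_weight n p S else 0)); last first.
  move=> p S pw; rewrite (bigD1_seq (lab p)) /=; first last.
  - exact: classical_crossings_uniq.
  - exact: lab_classical_crossings.
  by rewrite eqxx big1 ?addr0 // => c; rewrite eq_sym => /negPf->.
rewrite chord_sum_big /writhe big_mkcond [LHS]big_seq [RHS]big_seq.
apply: eq_bigr => c cD.
have [A [p [B [q [C [wE [lp lq] sq [cp hq] [nA nB nC]]]]]]] := crossing_split vD cD.
have gE := gword_split wE cp hq; rewrite gE in gw *.
rewrite chord_sum_one // (Ind_split wE lp lq sq cp hq nA nB nC).
rewrite (sgn_split wE lp lq sq cp hq nA nB nC) /index_weight /ovr /=.
by case: (is_over _); rewrite ?eqr_oppLR.
Qed.

(** Weight on the total shift for which the flat chord sum is the [n]-th dwrithe: the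
    term of a crossing of index [n] or [- n] is then determined by the side of its first
    passage and the total shift, whatever its levels. *)
Definition index_sign (n : nat) (S : int) : int :=
  (S == n%:Z)%:R - (S == - n%:Z)%:R.

Lemma index_sign_odd n S : index_sign n (- S) = - index_sign n S.
Proof. by rewrite /index_sign eqr_opp eqr_oppLR opprB. Qed.

Lemma dwrithe_chord_sum n D : valid_code (word D) ->
  dwrithe n D = chord_sum (flat_weight (index_sign n)) (gword (word D)).
Proof.
move=> vD; rewrite /dwrithe !writhe_chord_sum // -chord_sumB.
apply: eq_chord_sum => p S _; rewrite /index_weight /flat_weight /index_sign opprK.
by case: (ovr p); case: eqP => _; case: eqP => _ /=; ring.
Qed.

(** * The smoothed diagram *)

Lemma perm_eq_pair (T : eqType) (p q : T) s :
  perm_eq [:: p; q] s -> s = [:: p; q] \/ s = [:: q; p].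
Proof.
move=> ps; have := perm_size ps; case: s ps => [|a [|b []]] // ps _.
have : a \in [:: p; q] by rewrite (perm_mem ps) mem_head.
rewrite !inE => /orP[]/eqP ae; rewrite ae in ps *.
- by move: ps; rewrite perm_cons => /(@perm_small_eq _ [:: q] [:: b] isT) [->];
  left.
- move: ps; rewrite -[[:: p; q]]/([:: p] ++ [:: q]) perm_catC /= perm_cons.
  by move/(@perm_small_eq _ [:: p] [:: b] isT) => [[->]]; right.
Qed.

Lemma valid_code_perm w w' : perm_eq w w' -> valid_code w -> valid_code w'.
Proof.
move=> ww' /allP vw; apply/allP => x; rewrite -(perm_mem (perm_map label ww')).
move=> /vw /two_passagesP[p [q [fE sq hq]]]; rewrite /two_passages.
have := perm_filter (through x) ww'; rewrite fE => /perm_eq_pair[] ->.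
- by rewrite sq hq eqxx; case: (height p).
- by rewrite sq hq negbK eqxx; case: (height p).
Qed.

Lemma valid_code_exchange P w : valid_code w -> valid_code
  (map (exchange_sides P) w).
Proof.
have labE p : label (exchange_sides P p) = label p by rewrite /exchange_sides;
  case: ifP.
move=> /allP vw; apply/allP => x; rewrite -map_comp (eq_map labE).
move=> /vw /two_passagesP[p [q [fE sq hq]]]; rewrite /two_passages filter_map.
rewrite (eq_filter (a2 := through x)); last by move=> r; rewrite /= /through labE.
have : p \in [seq p <- w | through x p] by rewrite fE mem_head.
have : q \in [seq p <- w | through x p] by rewrite fE !inE eqxx orbT.
rewrite !mem_filter => /andP[/eqP lq _] /andP[/eqP lp _].
rewrite fE /= /exchange_sides lp lq; case: (P x) => /=; rewrite sq hq eqxx;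
by case: (height p).
Qed.

Lemma valid_code_remove c A p B q C : valid_code (A ++ p :: B ++ q :: C) ->
  label p = c -> label q = c ->
  ~~ has (through c) A -> ~~ has (through c) B -> ~~ has (through c) C ->
  valid_code (A ++ B ++ C).
Proof.
move=> /allP vw lp lq nA nB nC; apply/allP => x xw.
have xc : x != c.
  apply/eqP => xc; case/mapP: xw => r rw rx.
  have : has (through c) (A ++ B ++ C) by apply/hasP; exists r; rewrite //
    /through -rx xc.
  by rewrite !has_cat (negPf nA) (negPf nB) (negPf nC).
have : two_passages (A ++ p :: B ++ q :: C) x.
  apply: vw; move: xw; rewrite !(map_cat, map_cons) !(mem_cat, inE).
  by case/or3P => ->; rewrite ?orbT.
have px : through x p = false by rewrite /through lp eq_sym (negPf xc).
have qx : through x q = false by rewrite /through lq eq_sym (negPf xc).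
by rewrite /two_passages !filter_cat /= filter_cat /= px qx.
Qed.

Lemma gword_exchange P w : gword (map (exchange_sides P) w) =
  map (toggle P) (gword w).
Proof.
elim: w => //= p w IH; rewrite !gword_cons IH /exchange_sides.
case: (boolP (P (label p))) => Pp /=; case: ifP => //= _;
  by rewrite /endpoint_of /toggle /lab /lft /ovr /= ?(negPf Pp) ?Pp ?addbT ?addbF.
Qed.

Section Smooth.
Variables (D : diagram) (c : nat).
Hypotheses (vD : valid_code (word D)) (cD : c \in classical_crossings D).

(** The smoothed diagram is valid, and up to sign its dwrithe is the flat chord sum of
    [reverse_along]: when the first passage through [c] is over, it is the other path
    that is reversed. *)
Lemma abs_dwrithe_smooth n :
  valid_code (word (smooth D c)) /\
  `|dwrithe n (smooth D c)| = abs_smoothing (index_sign n) c (gword (word D)).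
Proof.
have [A [p [B [q [C [wE [lp lq] sq [cp hq] [nA nB nC]]]]]]] := crossing_split vD cD.
have gE := gword_split wE cp hq; have gw := valid_gauss vD.
have vABC : valid_code (A ++ B ++ C).
  by move: vD; rewrite wE => vw; apply: (valid_code_remove vw lp lq).
pose mixed x := has (through x) B && has (through x) (A ++ C).
have iE : find (through c) (word D) = size A.
  by rewrite wE find_cat (negPf nA) /= /through lp eqxx addn0.
have w1E : drop (size A).+1 (word D) = B ++ q :: C.
  by rewrite wE -cat_rcons drop_size_cat ?size_rcons.
have jE : find (through c) (B ++ q :: C) = size B.
  by rewrite find_cat (negPf nB) /= /through lq eqxx addn0.
have tE : take (size A).+1 (word D) = rcons A p.
  by rewrite wE -cat_rcons take_size_cat ?size_rcons.
have smE : word (smooth D c) = map (exchange_sides mixed)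
    (if is_under (height p) then A ++ rev B ++ C else rev (A ++ rev B ++ C)).
  rewrite /smooth iE w1E jE tE has_rcons /= /through lp eqxx /=.
  rewrite (_ : has _ A = false); last first.
    by apply: contraNF nA; apply: sub_has => r /= /andP[].
  rewrite orbF take_size_cat // -cat_rcons drop_size_cat ?size_rcons //.
  rewrite (_ : take (size A) (word D) = A); last by rewrite wE take_size_cat.
  case: ifP => _ //=; congr map; by rewrite !rev_cat revK -catA.
have pW : perm_eq (A ++ B ++ C) (A ++ rev B ++ C).
  by rewrite perm_cat2l perm_cat2r perm_sym perm_rev.
have vsm : valid_code (word (smooth D c)).
  rewrite smE; apply: valid_code_exchange; apply: valid_code_perm vABC.
  by case: ifP => // _; rewrite perm_sym perm_rev perm_sym.
split=> //; rewrite dwrithe_chord_sum // smE.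
have vABC' := valid_code_perm pW vABC.
set W := A ++ rev B ++ C in smE vABC' *.
have gW : gauss (gword W) by apply: valid_gauss.
have mixedE : map (toggle mixed) (gword W) = map (toggle (odd_in (gword B)))
  (gword W).
  apply/eq_in_map => r rW; rewrite /toggle; congr (_, _ (+) _, _).
  have [P /= PW rP] : exists2 P, P \in W & r = endpoint_of P /\ is_classical
    (height P).
    by case/mapP: rW => P; rewrite mem_filter => /andP[cP PW] ->; exists P.
  case: rP => rP cP; have -> : lab r = label P by rewrite rP.
  have [Q [fE _ hQ]] := valid_passages vABC' PW.
  have cQ : is_classical (height Q) by rewrite hQ; move: cP; case: (height P).
  have cB : count (on (label P)) (gword B) = count (through (label P)) B.
    rewrite /gword count_map count_filter -!size_filter; congr size.
    have subB : {subset B <= W} by move=> s sB; rewrite !mem_cat mem_rev sB orbT.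
    apply: eq_in_filter => s sB /=; rewrite /on /through /lab /=.
    case: eqP => // ls; have : s \in [seq r <- W | through (label P) r].
      by rewrite mem_filter /through ls eqxx subB.
    by case: fE => ->; rewrite !inE => /orP[]/eqP->; rewrite ?cP ?cQ.
  have : count (through (label P)) W = 2%N.
    by rewrite -size_filter; case: fE => ->.
  rewrite /odd_in cB /mixed !count_cat count_rev !has_cat !has_count.
  by case: (count _ A) => [|[|[|a]]]; case: (count _ B) => [|[|[|b]]];
     case: (count _ C) => [|[|[|d]]].
have godd := @index_sign_odd n.
have -> : `|chord_sum (flat_weight (index_sign n)) (gword
  (map (exchange_sides mixed)
     (if is_under (height p) then W else rev W)))| =
   `|chord_sum (flat_weight (index_sign n)) (map (toggle mixed) (gword W))|.
  rewrite gword_exchange; case: ifP => // _; rewrite gword_rev map_rev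
    chord_sum_rev ?normrN //.
  - exact: flatN.
  - by have /andP[] := gauss_toggle mixed gW.
rewrite mixedE gE; have := abs_smoothE (index_sign n) (A := gword A)
  (p := endpoint_of p) (B := gword B) (q := endpoint_of q) (C := gword C).
rewrite -gE /lab /= lp lq => -> //.
have gt := gauss_toggle (odd_in (gword B)) gW.
rewrite /smooth_sum /reverse_along; rewrite /W !gword_cat gword_rev in gt *.
by rewrite map_cat in gt *; rewrite (chord_sum_rot (flat_mate godd)) //
  -map_cat -catA.
Qed.
End Smooth.

(** * Renaming labels and changing levels *)

Section Rename.
Variables (f : nat -> nat) (h : endpoint -> endpoint).
Hypotheses (f_inj : injective f) (lab_h : forall p, lab (h p) = f (lab p))
  (lft_h : forall p, lft (h p) = lft p).

Lemma on_map x p : on (f x) (h p) = on x p.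
Proof. by rewrite /on lab_h (inj_eq f_inj). Qed.

Lemma find_on_map x w : find (on (f x)) (map h w) = find (on x) w.
Proof. by rewrite find_map; apply: eq_find => p /=; apply: on_map. Qed.

Lemma shift_map p : shift (h p) = shift p.
Proof. by rewrite /shift lft_h. Qed.

Variable g : int -> int.

Lemma chord_sum_flat_map w : chord_sum (flat_weight g) (map h w) =
  chord_sum (flat_weight g) w.
Proof.
apply: chord_sum_map => [p S _|p _|p q _ _]; rewrite ?/flat_weight ?shift_map //.
by rewrite !lab_h (inj_eq f_inj).
Qed.

Lemma abs_smooth_map x w : abs_smoothing g (f x) (map h w) = abs_smoothing g x w.
Proof.
rewrite /abs_smoothing /between /outside !find_on_map -!map_drop !find_on_map.
rewrite -?map_drop -?map_take -map_cat; move: (take _ _) (_ ++ _) => B C.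
congr (`|_|); rewrite /smooth_sum /reverse_along -map_rev -map_cat -map_comp.
have sE p : shift (toggle (odd_in (map h B)) (h p)) = shift (toggle (odd_in B) p).
  rewrite !shift_toggle lab_h shift_map /odd_in count_map.
  by rewrite (eq_count (a2 := on (lab p))) // => r; apply: on_map.
apply: chord_sum_map2 => [p S _|p _|p q _ _] /=.
- by rewrite /flat_weight sE.
- exact: sE.
- by rewrite !lab_toggle !lab_h (inj_eq f_inj).
Qed.

End Rename.

(** * Two invariants of diagrams *)

Definition relabel (f : nat -> nat) (p : endpoint) : endpoint :=
  (f (lab p), lft p, ovr p).

Section ChordSumInvariance.
Variable F : endpoint -> int -> int.
Hypothesis F_relabel : forall f p S, F (relabel f p) S = F p S.
Hypothesis F_mate : forall p S, F (mate p) (- S) = F p S.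
Hypothesis F_opp : forall p q S, ovr p = ovr q -> shift q = - shift p ->
  F p S + F q S = 0.
Hypothesis F_0 : forall p, F p 0 = 0.

Lemma chord_sum_relabel f w : injective f ->
  chord_sum F (map (relabel f) w) = chord_sum F w.
Proof.
move=> injf; apply: chord_sum_map => [p S _|p _|p q _ _] //.
by rewrite /relabel /lab /= (inj_eq injf).
Qed.

Lemma chord_sum_kink_head a w : gauss ([:: a; mate a] ++ w) ->
  chord_sum F ([:: a; mate a] ++ w) = chord_sum F w.
Proof.
move=> gw; have [_ _ mw] := gauss_misses (A := [::]) (B := [::]) gw erefl.
by apply: (chord_sum_kink (u := [::])); rewrite ?shift_mate.
Qed.

Lemma chord_sum_bigon_head x y P Q X Y l : bigon x y P Q ->
  gauss (P ++ X ++ Q ++ Y) -> {in P, forall p, ovr p = l} ->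
  chord_sum F (P ++ X ++ Q ++ Y) = chord_sum F (X ++ Y).
Proof.
move=> PQ gT ovP; have [[_ xX xY] [_ yX yY]] := bigon_misses (X := [::]) PQ gT.
apply: (chord_sum_bigon_out (u := [::]) _ PQ); rewrite ?misses_cat ?xX ?yX //.
by move=> p q S pP qP; apply: F_opp; rewrite !ovP.
Qed.

Lemma chord_sum_triangle_head x y z P Q R P' Q' R' X Y Z :
  triangle_flip x y z P Q R P' Q' R' ->
  gauss (P ++ X ++ Q ++ Y ++ R ++ Z) ->
  chord_sum F (P ++ X ++ Q ++ Y ++ R ++ Z) =
  chord_sum F (P' ++ X ++ Q' ++ Y ++ R' ++ Z).
Proof.
move=> tr gT; have [mx my mz] := triangle_misses_all tr gT.
exact: (chord_sum_triangle_flip (t := [::]) F tr).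
Qed.

(** Conditions on the weight for the chord sum to be an invariant: [F_opp] deals with
    bigons, [F_0] with kinks and [F_mate] with the base point. *)
Lemma chord_sum_equivalent D D' : equivalent D D' ->
  chord_sum F (gword (word D)) = chord_sum F (gword (word D')).
Proof.
apply: invariant_equivalent =>
  [f w injf _|u v|a w gw _|x y P Q X Y l PQ gT _ ovP _|].
- exact: chord_sum_relabel.
- exact: chord_sum_rot.
- exact: chord_sum_kink_head.
- exact: chord_sum_bigon_head PQ gT ovP.
- by move=> x y z P Q R P' Q' R' X Y Z tr gT _; apply: (chord_sum_triangle_head tr).
Qed.

End ChordSumInvariance.

Lemma index_weight_mate n p S : index_weight n (mate p) (- S) = index_weight n p S.
Proof.
rewrite /index_weight shift_mate /mate /ovr /= -/(ovr p) eqr_opp eqr_oppLR.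
by case: (ovr p); rewrite /= ?opprK.
Qed.

(** For [n = 0] invariance fails, because of the kinks. *)
Lemma writhe_equivalent n D D' : n != 0 -> equivalent D D' ->
  chord_sum (index_weight n) (gword (word D)) =
  chord_sum (index_weight n) (gword (word D')).
Proof.
move=> n0; apply: chord_sum_equivalent => //.
- exact: index_weight_mate.
- move=> p q S pq spq; rewrite /index_weight -pq spq.
  by case: (ovr p); case: ifP; rewrite ?addr0 // ?opprK ?subrr ?addNr.
- move=> p; rewrite /index_weight eq_sym oppr_eq0 [0 == n]eq_sym (negPf n0).
  by rewrite if_same.
Qed.

Section Flat.
Variables (g : int -> int) (k : int).
Hypothesis g_odd : forall S, g (- S) = - g S.

Lemma flat_opp p q S : ovr p = ovr q -> shift q = - shift p ->
  flat_weight g p S + flat_weight g q S = 0.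
Proof. by move=> _; apply: flat_bigon. Qed.

(** The smoothing count is an invariant except for [k] equal to the absolute flat chord
    sum of the word itself, when it is affected by kinks. *)
Definition smooth_invariant (w : seq endpoint) : option int :=
  if `|chord_sum (flat_weight g) w| == k then None else Some
    (smoothing_count g k w).

Lemma smooth_count_map f h w : injective f ->
  (forall p, lab (h p) = f (lab p)) -> (forall p, lft (h p) = lft p) ->
  smoothing_count g k (map h w) =
  \sum_(p <- w | ovr (h p) && (abs_smoothing g (lab p) w == k)) - shift p.
Proof.
move=> injf lab_h lft_h; rewrite /smoothing_count big_map; apply: eq_big => [p|p _].
  by rewrite lab_h (abs_smooth_map injf lab_h lft_h).
by rewrite (shift_map lft_h).
Qed.

Lemma smooth_invariant_equivalent D D' : equivalent D D' ->
  smooth_invariant (gword (word D)) = smooth_invariant (gword (word D')).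
Proof.
have fm := flat_mate g_odd; have f0 := flat0 g_odd.
apply: invariant_equivalent => [f w injf gw|u v gw|a w gw gw'
  |x y P Q X Y l PQ gT gXY ovP ovQ|x y z P Q R P' Q' R' X Y Z tr gT gT'];
  rewrite /smooth_invariant.
- by rewrite chord_sum_relabel // (smooth_count_map (f := f)).
- by rewrite chord_sum_rot // smooth_count_rot.
- rewrite chord_sum_kink_head //; case: eqP => // /eqP nk.
  by rewrite smooth_count_kink.
- rewrite (chord_sum_bigon_head flat_opp PQ gT ovP).
  by rewrite (smooth_count_bigon g_odd k PQ gT gXY ovP ovQ).
- rewrite (chord_sum_triangle_head _ tr gT).
  by rewrite (smooth_count_triangle g_odd k tr gT gT').
Qed.

End Flat.

(** * Switching a crossing *)

(** Exchanges the levels of the two passages with label [c]. *)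
Definition switch (c : nat) (p : endpoint) : endpoint :=
  if lab p == c then (lab p, lft p, ~~ ovr p) else p.

Lemma gword_crossing_change D c :
  gword (word (crossing_change D c)) = map (switch c) (gword (word D)).
Proof.
rewrite /gword filter_map -!map_comp /=.
have -> : [seq x <- word D | preim (change_passage c) (fun p =>
  is_classical (height p)) x]
   = [seq p <- word D | is_classical (height p)].
  by apply: eq_filter => p; rewrite /= /change_passage; case: ifP => //;
    case: (height p).
apply/eq_in_map => p; rewrite mem_filter => /andP[cp _].
rewrite /= /change_passage /through /switch /lab /endpoint_of /=; case: ifP => // _.
by rewrite /lft /ovr /=; move: cp; case: (height p).
Qed.

Lemma lab_switch c p : lab (switch c p) = lab p.
Proof. by rewrite /switch; case: ifP. Qed.
Lemma lft_switch c p : lft (switch c p) = lft p.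
Proof. by rewrite /switch; case: ifP. Qed.

Lemma shift_neq0 p : shift p != 0.
Proof. by rewrite /shift; case: (lft p). Qed.

(** Switching [c] replaces its index by the opposite and so removes its sign from the
    writhe of order [Ind D c]. *)
Lemma not_cosmetic_index D c : valid_code (word D) -> c \in classical_crossings D ->
  Ind D c != 0 -> ~ cosmetic D c.
Proof.
move=> vD cD n0 /(writhe_equivalent n0); rewrite gword_crossing_change.
have gw := valid_gauss vD.
rewrite (chord_sum_map (F := fun p => index_weight (Ind D c) (switch c p))) //;
  first last.
- by move=> p q _ _; rewrite !lab_switch.
- by move=> p _; rewrite /shift lft_switch.
(* Only c contributes to the difference of the two writhes. *)
move/eqP; rewrite -subr_eq0 -chord_sumB.
set n := Ind D c.
rewrite (@eq_chord_sum _ (fun p S => if lab p == c then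
   index_weight n (switch c p) S - index_weight n p S else 0)); last first.
  by move=> p S _; case: ifP => // lE; rewrite /switch lE subrr.
have [A [p [B [q [C [wE [lp lq] sq [cp hq] [nA nB nC]]]]]]] := crossing_split vD cD.
have nE := Ind_split wE lp lq sq cp hq nA nB nC.
rewrite (gword_split wE cp hq) in gw *; rewrite chord_sum_one //.
rewrite -/n in nE; have n2 : (n == - n) = false.
  by rewrite -addr_eq0 -mulr2n mulrn_eq0 /=; apply: negPf.
have -> : switch c (endpoint_of p) = (c, from_left p, ~~ is_over (height p)).
  by rewrite /switch /lab /= lp eqxx /lft /ovr /=.
rewrite /index_weight /ovr /shift /lft /=; case: (is_over _) nE => /= nE.
- have sE : shift_sum (gword B) = - n by rewrite nE opprK.
  rewrite sE eqxx [- n == n]eq_sym n2 sub0r opprK.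
  by case: (from_left p).
- by rewrite -nE n2 eqxx sub0r; case: (from_left p).
Qed.

(** Switching [c] changes its sign and leaves the other terms of the count unchanged. *)
Lemma not_cosmetic_smooth n D c : valid_code (word D) ->
  c \in classical_crossings D ->
  `|dwrithe n D| != `|dwrithe n (smooth D c)| -> ~ cosmetic D c.
Proof.
move=> vD cD nk /(smooth_invariant_equivalent `|dwrithe n (smooth D c)|
  (index_sign_odd n)).
have [_ kE] := abs_dwrithe_smooth vD cD n.
have godd := index_sign_odd n.
have gw := valid_gauss vD.
move: nk; rewrite dwrithe_chord_sum // => /negPf nk.
rewrite gword_crossing_change /smooth_invariant.
rewrite (chord_sum_flat_map (f := id)) //; first last.
- exact: lft_switch.
- exact: lab_switch.
rewrite nk => -[]; rewrite (@smooth_count_map _ _ id) //; first last.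
- exact: lft_switch.
- exact: lab_switch.
have [A [p [B [q [C [wE [lp lq] sq [cp hq] [nA nB nC]]]]]]] := crossing_split vD cD.
move: kE; rewrite /smoothing_count; set k := `|dwrithe n (smooth D c)|;
  move/esym/eqP.
rewrite (gword_split wE cp hq) in gw *; set W := _ ++ _ :: _ => kE.
have pm := perm_two_out (endpoint_of p) (endpoint_of q) (gword A) (gword B)
  (gword C).
rewrite -/W in pm; rewrite !(perm_big _ pm) /= !big_cons.
have [mA mB mC] := gauss_misses (p := endpoint_of p) (q := endpoint_of q) gw
  (etrans lq (esym lp)).
have -> : \sum_(r <- gword A ++ gword B ++ gword C |
     ovr (switch c r) && (abs_smoothing (index_sign n) (lab r) W == k)) - shift r =
  \sum_(r <- gword A ++ gword B ++ gword C |
     ovr r && (abs_smoothing (index_sign n) (lab r) W == k)) - shift r.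
  rewrite big_seq_cond [RHS]big_seq_cond; apply: eq_bigl => r.
  case: (boolP (r \in _)) => //= rABC; rewrite /switch.
  case: eqP => // rc; have := mem_on rABC rc; rewrite -lp.
  have : misses (label p) (gword A ++ gword B ++ gword C) by rewrite !misses_cat
    mA mB mC.
  by move/negPf => ->.
have ovs r : lab r = c -> ovr (switch c r) = ~~ ovr r.
  by move=> rc; rewrite /switch rc eqxx.
rewrite !ovs //.
have -> : lab (endpoint_of p) = c by [].
have -> : lab (endpoint_of q) = c by [].
rewrite kE !andbT; move: (\sum_(r <- _ | _) _) => rest.
have sqE : shift (endpoint_of q) = - shift (endpoint_of p).
  by rewrite (gauss_mate gw (etrans lq (esym lp))) shift_mate.
rewrite sqE opprK {2 4}/ovr /= hq.
have := shift_neq0 (endpoint_of p); move: (shift _) => s s0.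
move: cp; rewrite /ovr /=; case: (height p) => //= _ /eqP;
  rewrite (inj_eq (addIr rest)).
- by rewrite -addr_eq0 -mulr2n mulrn_eq0 /= (negPf s0).
- by rewrite eq_sym -addr_eq0 -mulr2n mulrn_eq0 /= (negPf s0).
Qed.

Theorem theorem5p3 (D : diagram) (c : nat)
    (hD : virtual_knot_diagram D) (hc : c \in classical_crossings D) :
  Ind D c <> 0 \/
  (exists n : nat,
     n \in index_set D /\
     dwrithe n (smooth D c) <> dwrithe n D /\
     dwrithe n (smooth D c) <> - dwrithe n D) ->
  ~ cosmetic D c.
Proof.
have /andP[vD _] := hD.
case=> [/eqP|[n [_ [/eqP ne /eqP neN]]]]; first exact: not_cosmetic_index.
apply: (not_cosmetic_smooth (n := n)) => //; rewrite eq_sym.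
by rewrite eqr_norm2 negb_or ne.
Qed.
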